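(* Let $\{V_n;\,n\ge1\}$ be independent $\mathbf B$-valued random variables and $\{a_n;\,n\ge1\}$ nonnegative reals with $\sum_n a_n<\infty$. Set $b_n=\sum_{i=n}^\infty a_i$, $T_n=\sum_{i=1}^nV_i$, $N=\sup_{n\ge1}b_n\|V_n\|$, $L=\sum_{n=1}^\infty a_n\|T_n\|$, $M=\sum_{n=1}^\infty b_n\|V_n\|$, and $\Gamma(t)=\sum_{n=1}^\infty\mathbb P(b_n\|V_n\|>t)$ for $t\ge0$. Then $L\le M$. Suppose moreover that $\sup_{n\ge1}\mathbb P(b_n\|V_n\|>a)<1$ for some $a\ge0$. Then: (a) $L<\infty$ a.s. implies $N<\infty$ a.s.; and $N<\infty$ a.s. if and only if $\inf_{r\ge0}\Gamma(r)<\infty$. (b) $\mathbb EN<\infty$ if and only if $\int_r^\infty\Gamma(t)\,dt<\infty$ for some $r\ge0$. (c) $\mathbb EL<\infty$ if and only if ($L<\infty$ a.s. and $\mathbb EN<\infty$). (d) If $\mathbb EL<\infty$, then $\mathbb E\|V_n\|<\infty$ for every $n$ with $b_n>0$, and $b_n\,\mathbb E\|T_n-\mathbb ET_n\|\to0$ as $n\to\infty$ (terms with $b_n=0$ being interpreted as $0$). (e) If $\sum_{n=1}^\infty b_n=\infty$ and $L<\infty$ a.s., then $\liminf_{n\to\infty}\|T_n\|/n=0$ a.s.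
   Context: $(\mathbf{B},\|\cdot\|)$ is a real separable Banach space with its Borel $\sigma$-algebra. $\mathbb{E}$ of a $\mathbf B$-valued random variable denotes the Pettis integral (which exists whenever $\mathbb E\|\cdot\|<\infty$). *)

(* Defs.v *)
From HB Require Import structures.
From mathcomp Require Import all_boot all_order all_algebra.
From mathcomp Require Import all_classical all_reals all_analysis.
Set Implicit Arguments. Unset Strict Implicit. Unset Printing Implicit Defensive.
Import Order.TTheory GRing.Theory Num.Theory.
Import numFieldNormedType.Exports.
Local Open Scope classical_set_scope.
Local Open Scope ring_scope.

Definition separable_space (T : topologicalType) : Prop :=
  exists D : set T, countable D /\ closure D = setT.

Definition borel_set (T : topologicalType) (A : set T) : Prop :=
  <<s [set U : set T | open U] >> A.

Definition borel_measurable {d} (Om : measurableType d) (T : topologicalType)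
  (X : Om -> T) : Prop :=
  forall A : set T, borel_set A -> measurable (X @^-1` A).

Definition independent_seq {d} (Om : measurableType d) (R : realType)
  (P : probability Om R) (T : topologicalType) (V : nat -> Om -> T) : Prop :=
  forall (I : seq nat) (A : nat -> set T), uniq I ->
    (forall i, borel_set (A i)) ->
    P (\bigcap_(i in [set` I]) (V i @^-1` A i)) =
    (\big[*%E/1%E]_(i <- I) P (V i @^-1` A i))%E.

Definition pettis_mean {d} (Om : measurableType d) (R : realType)
  (P : probability Om R) (B : normedModType R) (X : Om -> B) (x : B) : Prop :=
  forall f : B -> R,
    (forall u v, f (u + v) = f u + f v) ->
    (forall (k : R) u, f (k *: u) = k * f u) ->
    continuous f ->
    P.-integrable setT (fun w => (f (X w))%:E) /\
    (\int[P]_w (f (X w))%:E = (f x)%:E)%E.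

Definition tailsum (R : realType) (a : nat -> R) (n : nat) : R :=
  \big[+%R/0%R]_(n <= i <oo) a i.

(* partial sums T_n = V_0 + ... + V_n  (0-based indexing) *)
Definition psum {Om : Type} (R : realType) (B : normedModType R)
  (V : nat -> Om -> B) (n : nat) (w : Om) : B :=
  \sum_(i < n.+1) V i w.

(* Main.v *)
Require Import Defs.
From HB Require Import structures.
From mathcomp Require Import all_boot all_order all_algebra.
From mathcomp Require Import all_classical all_reals all_analysis.
From mathcomp Require Import measurable_realfun ring lra.
Set Implicit Arguments.
Unset Strict Implicit.
Unset Printing Implicit Defensive.
Import Order.TTheory GRing.Theory Num.Theory.
Import numFieldNormedType.Exports.
Local Open Scope classical_set_scope.
Local Open Scope ring_scope.

(* The sequence space is normed by ell x = sum_n a_n |x_0 + ... + x_n|, so that L = ell V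
   and a sequence supported at the single coordinate n has norm b_n |x_n|; thus L is the
   norm of a sum of independent vectors whose largest summand is N.  For the symmetrization
   X = V - V' by an independent copy, Levy's inequality bounds the tails of the largest
   summand and of all partial sums by those of ell X, and the Hoffmann-Jorgensen inequality
   P(ell X > 3t) <= 4 P(ell X > t)^2 + P(N^s > t) turns integrability of the largest summand
   into integrability of ell X.  The assumption sup_n P(b_n |V_n| > c) < 1 removes the
   symmetrization from N, giving P(N > t + c) <= (4 / delta) P(L > t / 2), and Fubini removes
   it from L.  The sum Gamma(t) is compared with P(N > t) through
   Gamma(t) P(N <= t) <= P(N > t) <= Gamma(t).  For the means, a norming functional gives
   |y - E X| <= E |y - X|, whence E |T_n - E T_n| <= E |T^s_n|, which is nondecreasing in n;
   so b_n E |T_n - E T_n| is at most a tail of the convergent series sum_k a_k E |T^s_k|.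
   The last assertion is deterministic, since sum_n b_n = sum_n (n + 1) a_n. *)

(** * A norming functional *)

(** The probability space carries only [V], so the independent copy is built on [Om * Om] with the
    product measure, and the two copies together form one family indexed by [bool * nat].
    Independence is given only for finitely many coordinate events, while the inequalities concern
    functionals of the whole sequence. Statements about laws are therefore moved to the space of
    sequences with the sigma-algebra generated by the coordinates, where a pi-system argument
    identifies two laws. Symmetrization is forced because Levy's argument reflects part of the
    coordinates, which preserves the law of [V - V'] but not that of [V]. The functional [ell] may
    be infinite, so the maximal inequalities are proved for extended values, and integrals are
    tested against weighted tails along powers of 3, the ratio by which Hoffmann-Jorgensen enlarges
    the level. Starting where the tail is at most 1/24 makes the quadratic term contribute a factor
    3 * 4 / 24 = 1/2, which is absorbed. The Pettis means must be constructed as well: separability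
    gives measurable countably based approximations, completeness gives the limit of their means. *)

Section hahn_banach.
Context {R : realType} {B : normedModType R}.

(** Partial linear functionals are kept as graphs so that the union of a chain is an upper bound.
    Single-valuedness follows from the clauses: two values over one point differ by at most the norm
    of 0. *)
Definition contractive_graph (G : set (B * R)) : Prop :=
  [/\ forall p q, G p -> G q -> G (p.1 + q.1, p.2 + q.2),
      forall (k : R) p, G p -> G (k *: p.1, k * p.2) &
      forall p, G p -> p.2 <= `|p.1|].

(** A value [c] at [z] is admissible when it lies above every [q.2 - |q.1 - z|] and below every
    [|q'.1 + z| - q'.2]. The triangle inequality places the first numbers below the second, so the
    supremum of the first serves. A general multiple [t *: z] reduces to these two bounds after
    division by [|t|]. *)
Lemma contractive_graph_extend (G : set (B * R)) (z : B) :
  G (0, 0) -> contractive_graph G ->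
  exists c : R, contractive_graph
    [set p | exists q (t : R), [/\ G q, p.1 = q.1 + t *: z & p.2 = q.2 + t * c]].
Proof.
move=> G0 [GD GZ Gn].
pose S := [set q.2 - `|q.1 - z| | q in G].
have Sub q' : G q' -> ubound S (`|q'.1 + z| - q'.2).
  move=> Gq' _ [q Gq <-].
  have /= := Gn _ (GD _ _ Gq Gq').
  have -> : q.1 + q'.1 = (q.1 - z) + (q'.1 + z) by rewrite addrACA addNr addr0.
  move=> h; have := le_trans h (ler_normD _ _); lra.
have S0 : S !=set0 by exists (0 - `|0 - z|), (0, 0).
have supS : has_sup S by split => //; exists (`|0 + z| - 0); exact: (Sub (0,0)).
exists (sup S); split.
- move=> p p' [q [t [Gq e1 e2]]] [q' [t' [Gq' e1' e2']]].
  exists (q.1 + q'.1, q.2 + q'.2), (t + t'); split; first exact: GD.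
    by rewrite e1 e1' /= scalerDl addrACA.
  by rewrite e2 e2' /=; ring.
- move=> k p [q [t [Gq e1 e2]]].
  exists (k *: q.1, k * q.2), (k * t); split; first exact: GZ.
    by rewrite e1 /= scalerDr scalerA.
  by rewrite e2 /=; ring.
- move=> p [q [t [Gq -> ->]]].
  have [->|tn] := eqVneq t 0; first by rewrite scale0r mul0r !addr0; exact: Gn.
  move: tn; rewrite neq_lt => /orP[] t0; have tn : t != 0 by rewrite neq_lt t0 ?orbT.
  + have Gq' : G ((- t^-1) *: q.1, (- t^-1) * q.2) by exact: GZ.
    have /(ub_le_sup supS.2) /= h : S ((- t^-1) * q.2 - `|(- t^-1) *: q.1 - z|).
      by exists (- t^-1 *: q.1, - t^-1 * q.2).
    have -> : q.1 + t *: z = (- t) *: ((- t^-1) *: q.1 - z).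
      by rewrite scalerBr scalerA mulrNN divff // scale1r scaleNr opprK.
    rewrite normrZ gtr0_norm ?oppr_gt0//.
    have tt : 0 < - t by rewrite oppr_gt0.
    have := ler_wpM2l (ltW tt) h; rewrite mulrBr mulrA mulrNN divff//; lra.
  + have Gq' : G (t^-1 *: q.1, t^-1 * q.2) by exact: GZ.
    have h : sup S <= `|t^-1 *: q.1 + z| - t^-1 * q.2.
      by apply: ge_sup => //; exact: (Sub _ Gq').
    have -> : q.1 + t *: z = t *: (t^-1 *: q.1 + z).
      by rewrite scalerDr scalerA divff// scale1r.
    rewrite normrZ gtr0_norm//.
    have := ler_wpM2l (ltW t0) h; rewrite mulrBr mulrA divff//; lra.
Qed.

Lemma norming_functional (x : B) : exists f : B -> R,
  [/\ forall u v, f (u + v) = f u + f v,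
      forall (k : R) u, f (k *: u) = k * f u,
      forall y, `|f y| <= `|y| & f x = `|x|].
Proof.
pose G0 : set (B * R) := [set p | exists t : R, p = (t *: x, t * `|x|)].
(* The guard [A !=set0] lets the empty chain, whose union is empty, satisfy the Zorn hypothesis. The
   maximal [G] is nonempty anyway, since otherwise [G0] would be strictly larger. *)
have [G [[[GD GZ Gn] G0G] maxG]] : exists A, (contractive_graph A /\ (A !=set0 -> G0 `<=` A)) /\
    forall A', A `<` A' -> ~ (contractive_graph A' /\ (A' !=set0 -> G0 `<=` A')).
  apply: Zorn_bigcup => F FP totF; split; last first.
    move=> [p [X FX Xp]] q /(FP _ FX).2 h; exists X => //; apply: h; by exists p.
  split.
  - move=> p q [X FX Xp] [Y FY Yq].
    have [XY|YX] := totF _ _ FX FY.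
      by exists Y => //; have [[h _ _] _] := FP _ FY; apply: h => //; exact: XY.
    by exists X => //; have [[h _ _] _] := FP _ FX; apply: h => //; exact: YX.
  - by move=> k p [X FX Xp]; exists X => //; have [[_ h _] _] := FP _ FX; exact: h.
  - by move=> p [X FX Xp]; have [[_ _ h] _] := FP _ FX; exact: h.
have cG0 : contractive_graph G0.
  split.
  - by move=> _ _ [t ->] [t' ->]; exists (t + t'); rewrite /= scalerDl mulrDl.
  - by move=> k _ [t ->]; exists (k * t); rewrite /= scalerA mulrA.
  - by move=> _ [t ->] /=; rewrite normrZ ler_wpM2r// ler_norm.
have Gn0 : G !=set0.
  apply/set0P/eqP => GE; apply: (maxG G0); last (split; [exact: cG0|by move=> _ ?]).
  by rewrite GE; split; [by []|move=> h]; apply: (h (0 *: x, 0 * `|x|)); exists 0.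
have {G0G} G0G := G0G Gn0.
have G00 : G (0, 0) by apply: G0G; exists 0; rewrite scale0r mul0r.
have Gtot z : exists r, G (z, r).
  have [c Hc] := contractive_graph_extend z G00 (And3 GD GZ Gn).
  set G' := (X in contractive_graph X) in Hc.
  have GG' : G `<=` G'.
    by move=> p Gp; exists p, 0; split=> //; rewrite ?scale0r ?mul0r addr0.
  have G'z : G' (z, c) by exists (0, 0), 1; rewrite /= !add0r scale1r mul1r.
  have [//|nG] := pselect (exists r, G (z, r)).
  exfalso; apply: (maxG G'); last by split=> // _; exact: subset_trans GG'.
  by split=> // h; apply: nG; exists c; exact: h.
have Guniq z r r' : G (z, r) -> G (z, r') -> r = r'.
  have le s s' : G (z, s) -> G (z, s') -> s <= s'.
    move=> Gs /(GZ (-1)) /(GD _ _ Gs) /Gn /=.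
    by rewrite scaleN1r subrr normr0 mulN1r subr_le0.
  by move=> h h'; apply/eqP; rewrite eq_le !le.
pose f z := projT1 (cid (Gtot z)).
have Gf z : G (z, f z) by rewrite /f; case: cid.
have fZ k u : f (k *: u) = k * f u by apply: Guniq (Gf _) (GZ k _ (Gf u)).
exists f; split => //.
- by move=> u v; apply: Guniq (Gf _) (GD _ _ (Gf u) (Gf v)).
- move=> y; rewrite ler_norml (Gn _ (Gf y)) andbT lerNl -mulN1r -fZ scaleN1r.
  by rewrite (le_trans (Gn _ (Gf (- y))))//= normrN.
- by apply: Guniq (Gf _) _; apply: G0G; exists 1; rewrite scale1r mul1r.
Qed.

Lemma continuous_of_contractive (f : B -> R) :
  (forall u v, f (u + v) = f u + f v) -> (forall (k : R) u, f (k *: u) = k * f u) ->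
  (forall y, `|f y| <= `|y|) -> continuous f.
Proof.
move=> fD fZ fn x; apply/cvgrPdist_le => e e0.
near=> y; have -> : f x - f y = f (x - y) by rewrite fD -(scaleN1r y) fZ mulN1r.
by apply: le_trans (fn _) _; near: y; apply: cvgr_dist_le.
Unshelve. all: by end_near. Qed.

End hahn_banach.

(** * Borel measurability in a separable normed space *)

Lemma dense_sequence (R : realType) (B : normedModType R) :
  separable_space B -> exists c : nat -> B, forall z e, 0 < e -> exists n, `|z - c n| < e.
Proof.
move=> [D [cD clD]].
have dens z e : 0 < e -> exists2 x, D x & `|z - x| < e.
  move=> e0; have : closure D z by rewrite clD.
  move=> /(_ (ball z e)) [|x [Dx]]; first exact: nbhsx_ballx.
  by rewrite -ball_normE /= => h; exists x.
have /pfcard_geP[D0|[f]] := cD.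
  by have [x] := dens 0 1 ltr01; rewrite D0.
exists f => z e /(dens z)[x Dx xe].
by have [n _ fn] := @surj _ _ _ _ f x Dx; exists n; rewrite fn.
Qed.

Section borel_measurable.
Context {d} {Om : measurableType d}.

Lemma borel_measurable_open (T : topologicalType) (X : Om -> T) :
  (forall U, open U -> measurable (X @^-1` U)) -> borel_measurable X.
Proof.
move=> XU A; apply: (@smallest_sub _ _ _ [set A | measurable (X @^-1` A)]) => //.
split => /=.
- by rewrite preimage_set0.
- by move=> C mC; rewrite setTD preimage_setC; exact: measurableC.
- by move=> F mF; rewrite preimage_bigcup; exact: bigcupT_measurable.
Qed.

Lemma borel_open (T : topologicalType) (U : set T) : open U -> borel_set U.
Proof. exact: sub_sigma_algebra. Qed.

Lemma borel_measurable_cst (T : topologicalType) (c : T) :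
  borel_measurable (fun _ : Om => c).
Proof. by move=> A _; rewrite preimage_cst; case: ifPn => _; [exact: measurableT|exact: measurable0]. Qed.

Lemma borel_measurable_continuous (T T' : topologicalType) (g : T -> T') (X : Om -> T) :
  continuous g -> borel_measurable X -> borel_measurable (g \o X).
Proof.
move=> /continuousP cg bX; apply: borel_measurable_open => U oU.
by rewrite comp_preimage; apply: bX; apply: borel_open; exact: cg.
Qed.

Lemma borel_measurable_comp d' (Om' : measurableType d') (T : topologicalType)
    (f : Om' -> Om) (X : Om -> T) :
  measurable_fun setT f -> borel_measurable X -> borel_measurable (X \o f).
Proof.
move=> mf bX A bA; rewrite comp_preimage -[_ @^-1` _]setTI.
by apply: mf => //; exact: bX.
Qed.

Lemma borel_measurable_real (R : realType) (f : Om -> R) :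
  borel_measurable f -> measurable_fun setT f.
Proof.
move=> bf; apply: (measurability (@RGenOInfty.G R)) => [|_ [_ [x ->] <-]].
  exact: RGenOInfty.measurableE.
rewrite setTI; apply: bf; apply: borel_open; exact: rray_open.
Qed.

Lemma borel_measurable_norm (R : realType) (B : normedModType R) (X : Om -> B) :
  borel_measurable X -> measurable_fun setT (fun w => `|X w|).
Proof.
move=> bX; apply: borel_measurable_real.
by apply: (@borel_measurable_continuous B R (fun x => `|x|)) => //; exact: norm_continuous.
Qed.

Lemma borel_measurableZ (R : realType) (B : normedModType R) (k : R) (X : Om -> B) :
  borel_measurable X -> borel_measurable (fun w => k *: X w).
Proof. by apply: (borel_measurable_continuous (@scaler_continuous _ B k)). Qed.

(** Separability enters here: the Borel sets of [B * B] need not be generated by rectangles in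
    general. With a dense sequence, the preimage of an open [U] under addition is a countable union
    of rectangles of small balls whose sums stay in [U]. *)
Lemma borel_measurableD (R : realType) (B : normedModType R) (X Y : Om -> B) :
  separable_space B -> borel_measurable X -> borel_measurable Y ->
  borel_measurable (fun w => X w + Y w).
Proof.
move=> /dense_sequence [c dens] bX bY; apply: borel_measurable_open => U oU.
pose I i j := [set n : nat | forall u v, `|u - c i| < n.+1%:R^-1 ->
  `|v - c j| < n.+1%:R^-1 -> U (u + v)].
rewrite (_ : _ @^-1` _ = \bigcup_i \bigcup_j \bigcup_(n in I i j)
   ((fun w => `|X w - c i|) @^-1` `]-oo, (n.+1%:R^-1)[ `&`
    (fun w => `|Y w - c j|) @^-1` `]-oo, (n.+1%:R^-1)[)); last first.
  apply/seteqP; split => [w /= Uw|w /= [i _ [j _ [n h]]]]; last first.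
    by rewrite /= !in_itv /= => -[? ?]; exact: h.
  have /nbhs_ballP[e /= e0 eU] : nbhs (X w + Y w) U by exact: open_nbhs_nbhs.
  (* Four distances to the centres [c i] and [c j] are added: those of [X w], [u], [Y w] and [v]. *)
  have e40 : 0 < e / 4 by rewrite divr_gt0.
  have [n _ /(_ n (leqnn _))] := near_infty_natSinv_lt (PosNum e40).
  move=> ne0; have ne : n.+1%:R^-1 < e / 4 := ne0.
  have n0 : 0 < n.+1%:R^-1 :> R by rewrite invr_gt0.
  have [i iX] := dens (X w) _ n0; have [j jY] := dens (Y w) _ n0.
  exists i => //; exists j => //; exists n; last by rewrite /= !in_itv.
  move=> u v /= ux vy; apply: eU; rewrite -ball_normE /=.
  have -> : X w + Y w - (u + v) = (X w - c i) - (u - c i) + ((Y w - c j) - (v - c j)).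
    by rewrite !opprB !subrKA opprD addrACA.
  have := ler_normD (X w - c i - (u - c i)) (Y w - c j - (v - c j)).
  have h1 := ler_normB (X w - c i) (u - c i).
  have h2 := ler_normB (Y w - c j) (v - c j).
  move=> h3; apply: le_lt_trans h3 _; set r := n.+1%:R^-1 in iX jY ux vy ne *; lra.
apply: bigcupT_measurable => i; apply: bigcupT_measurable => j.
apply: bigcup_measurable => n _.
have mb (Z : Om -> B) z r : borel_measurable Z -> measurable ((fun w => `|Z w - z|) @^-1` `]-oo, r[).
  move=> bZ; rewrite (_ : _ @^-1` _ = Z @^-1` ball z r).
    by apply: bZ; apply: borel_open; exact: ball_open.
  by apply/seteqP; split => w /=; rewrite in_itv /= -ball_normE /= distrC.
by apply: measurableI; exact: mb.
Qed.

Lemma borel_measurableB (R : realType) (B : normedModType R) (X Y : Om -> B) :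
  separable_space B -> borel_measurable X -> borel_measurable Y ->
  borel_measurable (fun w => X w - Y w).
Proof.
move=> sB bX bY; rewrite (_ : (fun _ => _) = (fun w => X w + (-1) *: Y w)).
  by apply: borel_measurableD => //; exact: borel_measurableZ.
by apply/funext => w; rewrite scaleN1r.
Qed.

Lemma borel_measurable_sum (R : realType) (B : normedModType R) (X : nat -> Om -> B) n :
  separable_space B -> (forall i, borel_measurable (X i)) ->
  borel_measurable (fun w => \sum_(i < n) X i w).
Proof.
move=> sB bX; elim: n => [|n ih].
  rewrite (_ : (fun _ => _) = fun=> 0); first exact: borel_measurable_cst.
  by apply/funext => w; rewrite big_ord0.
rewrite (_ : (fun _ => _) = fun w => \sum_(i < n) X i w + X n w).
  exact: borel_measurableD.
by apply/funext => w; rewrite big_ord_recr.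
Qed.

End borel_measurable.

(** * Pettis means *)

Section pettis.
Context {d} {Om : measurableType d} {R : realType} (P : probability Om R).
Local Open Scope ereal_scope.

Lemma integral_probability_cst (r : \bar R) : \int[P]_w r = r.
Proof.
transitivity (r * P setT); first exact: integral_cst.
by rewrite probability_setT mule1.
Qed.

Lemma pettis_meanD (B : normedModType R) (X Y : Om -> B) (x y : B) :
  pettis_mean P X x -> pettis_mean P Y y ->
  pettis_mean P (fun w => X w + Y w)%R (x + y)%R.
Proof.
move=> pX pY f fD fZ fc; have [iX eX] := pX f fD fZ fc; have [iY eY] := pY f fD fZ fc.
rewrite (_ : (fun _ => _) = (fun w => (f (X w))%:E + (f (Y w))%:E)); last first.
  by apply/funext => w; rewrite fD EFinD.
split; first exact: integrableD.
by rewrite integralD// eX eY fD EFinD.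
Qed.

Lemma pettis_mean_cst (B : normedModType R) (A : set Om) (c : B) : measurable A ->
  pettis_mean P (fun w => \1_A w *: c)%R (fine (P A) *: c)%R.
Proof.
move=> mA f fD fZ fc.
rewrite (_ : (fun _ => _) = (fun w => (f c)%:E * (\1_A w)%:E)); last first.
  by apply/funext => w; rewrite fZ muleC -EFinM.
have iA : P.-integrable setT (fun w => (\1_A w)%:E).
  by apply: integrable_indic => //; rewrite -ge0_fin_numE// fin_num_measure.
split; first exact: integrableZl.
by rewrite integralZl// integral_indic// setIT fZ mulrC EFinM fineK// fin_num_measure.
Qed.

Lemma pettis_meanN (B : normedModType R) (X : Om -> B) (x : B) :
  pettis_mean P X x -> pettis_mean P (fun w => - X w)%R (- x)%R.
Proof.
move=> pX f fD fZ fc; have [iX eX] := pX f fD fZ fc.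
have fN u : f (- u)%R = (- f u)%R by rewrite -scaleN1r fZ mulN1r.
rewrite (_ : (fun _ => _) = (fun w => - (f (X w))%:E)); last first.
  by apply/funext => w; rewrite fN.
split; first exact: integrableN.
by rewrite integralN ?eX ?fN// integrable_add_def.
Qed.

(** With [y = 0] this makes the means of approximations Cauchy; with [y] a value of an independent
    copy it bounds the centred sums. *)
Lemma pettis_mean_norm_le (B : normedModType R) (X : Om -> B) (x y : B) :
  borel_measurable X -> separable_space B -> pettis_mean P X x ->
  (`|y - x|)%:E <= \int[P]_w (`|y - X w|)%:E.
Proof.
move=> bX sB pX.
have [f [fD fZ fn fy]] := norming_functional (y - x)%R.
have [iX eX] := pX f fD fZ (continuous_of_contractive fD fZ fn).
have fB u v : f (u - v)%R = (f u - f v)%R by rewrite fD -(scaleN1r v) fZ mulN1r.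
have iy : P.-integrable setT (EFin \o (fun _ : Om => f y)).
  exact: finite_measure_integrable_cst.
have -> : (`|y - x|)%:E = \int[P]_w ((f y)%:E - (f (X w))%:E).
  rewrite -fy fB EFinB (@integralB_EFin _ _ _ P setT (fun=> f y) (f \o X))//.
  rewrite -eX; congr (_ - _).
  by rewrite [RHS](integral_probability_cst (f y)%:E).
apply: le_trans (lee_abs _) _.
apply: le_trans; first apply: le_abse_integral => //.
  apply: measurable_int; apply: (integrableB measurableT iy iX).
apply: ge0_le_integral => //.
- apply: measurableT_comp => //.
  apply: measurable_int; apply: (integrableB measurableT iy iX).
- apply/measurable_EFinP; apply: borel_measurable_norm.
  by apply: borel_measurableB => //; exact: borel_measurable_cst.
- by move=> w _; rewrite -EFinB abse_EFin lee_fin -fB.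
Qed.

Lemma borel_measurable_if (B : topologicalType) (A : set Om) (X Y : Om -> B) :
  measurable A -> borel_measurable X -> borel_measurable Y ->
  borel_measurable (fun w => if w \in A then X w else Y w).
Proof.
move=> mA bX bY C bC.
rewrite (_ : _ @^-1` _ = (A `&` X @^-1` C) `|` (~` A `&` Y @^-1` C)).
  apply: measurableU; apply: measurableI => //; [exact: bX|exact: measurableC|exact: bY].
apply/seteqP; split => w /=.
  by case: ifPn => [/set_mem Aw|/negP Aw] h; [left|right; split => // /mem_set].
by move=> [[Aw h]|[Aw h]]; [rewrite mem_set|rewrite memNset].
Qed.

(** A best approximation of [x] among 0 and the first [k] points of the sequence. Including 0 keeps
    the error below [|x|], which supplies the dominating function later. *)
Fixpoint nearest (B : normedModType R) (c : nat -> B) (k : nat) (x : B) : B :=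
  if k is k'.+1 then
    if (`|x - c k'| < `|x - nearest c k' x|)%R then c k' else nearest c k' x
  else 0%R.

Lemma nearest_le (B : normedModType R) (c : nat -> B) k x : (`|x - nearest c k x| <= `|x|)%R.
Proof.
by elim: k => [|k ih] /=; [rewrite subr0|case: ifPn => // /ltW /le_trans; exact].
Qed.

Lemma nearest_cvg (B : normedModType R) (c : nat -> B) x :
  (forall z e, (0 < e)%R -> exists n, (`|z - c n| < e)%R) ->
  (fun k => (`|x - nearest c k x|)%:E) @ \oo --> 0.
Proof.
move=> dens; have close n k : (n < k)%N -> (`|x - nearest c k x| <= `|x - c n|)%R.
  elim: k => // k ih; rewrite ltnS leq_eqVlt /= => /orP[/eqP->|/ih h]; case: ifPn => //.
    by rewrite -leNgt.
  by move=> /ltW /le_trans; exact.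
apply/fine_cvgP; split; first exact: nearW.
apply/cvgrPdist_lt => e e0; have [n ne] := dens x e e0.
exists n.+1 => // k /= nk; rewrite sub0r normrN normr_id.
exact: le_lt_trans (close _ _ nk) ne.
Qed.

Lemma borel_measurable_nearest (B : normedModType R) (c : nat -> B) k (X : Om -> B) :
  separable_space B -> borel_measurable X -> borel_measurable (nearest c k \o X).
Proof.
move=> sB bX; elim: k => [|k ih]; first exact: borel_measurable_cst.
pose A := [set w | `|X w - c k| < `|X w - nearest c k (X w)|]%R.
have -> : nearest c k.+1 \o X = fun w => if w \in A then c k else nearest c k (X w).
  by apply/funext => w /=; case: ifPn => h; [rewrite mem_set|rewrite memNset//; apply/negP].
apply: borel_measurable_if => //; last exact: borel_measurable_cst.
rewrite -[A]setTI; apply: (@measurable_fun_ltr _ _ _ setT) => //.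
- by apply: borel_measurable_norm; apply: borel_measurableB => //; exact: borel_measurable_cst.
- by apply: borel_measurable_norm; exact: borel_measurableB.
Qed.

(** The indicator of an arbitrary [A] makes the induction close: on [A] the new point [c k] is taken
    on a measurable part [E], and the induction hypothesis is applied to what is left of [A]. *)
Lemma pettis_mean_nearest (B : normedModType R) (c : nat -> B) k (X : Om -> B) (A : set Om) :
  separable_space B -> borel_measurable X -> measurable A ->
  exists m, pettis_mean P (fun w => \1_A w *: nearest c k (X w))%R m.
Proof.
move=> sB bX; elim: k A => [|k ih] A mA; first by exists (fine (P A) *: 0)%R; exact: pettis_mean_cst.
pose E := [set w | `|X w - c k| < `|X w - nearest c k (X w)|]%R.
have mE : measurable E.
  rewrite -[E]setTI; apply: (@measurable_fun_ltr _ _ _ setT) => //.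
  - by apply: borel_measurable_norm; apply: borel_measurableB => //; exact: borel_measurable_cst.
  - by apply: borel_measurable_norm; apply: borel_measurableB => //; exact: borel_measurable_nearest.
have [m pm] := ih (A `&` ~` E) (measurableI _ _ mA (measurableC mE)).
exists (fine (P (A `&` E)) *: c k + m)%R.
have := pettis_meanD (pettis_mean_cst (c k) (measurableI _ _ mA mE)) pm.
congr (pettis_mean P _ _); apply/funext => w /=.
rewrite !indicE !in_setI in_setC.
case: ifPn => h; [rewrite (mem_set (h : E w))|rewrite (memNset (negP h : ~ E w))].
  by rewrite andbT andbF scale0r addr0.
by rewrite andbT andbF scale0r add0r.
Qed.

Lemma linear_continuous_bound (B : normedModType R) (f : B -> R) :
  (forall u v, f (u + v) = f u + f v)%R -> (forall (k : R) u, f (k *: u) = k * f u)%R ->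
  continuous f -> exists2 C : R, (0 < C)%R & forall y, (`|f y| <= C * `|y|)%R.
Proof.
move=> fD fZ fc.
have f0 : f 0%R = 0%R by rewrite -[X in f X](scale0r 0%R) fZ mul0r.
have /cvgrPdist_lt /(_ 1%R ltr01) := fc 0%R.
move=> /nbhs_ballP [e /= e0 he].
exists (2 / e)%R; first by rewrite divr_gt0.
move=> y; have [->|y0] := eqVneq y 0%R; first by rewrite f0 !normr0 mulr0.
have ny : (0 < `|y|)%R by rewrite normr_gt0.
(* Scales [y] to norm [e / 2], inside the ball on which [f] stays below 1. *)
pose k := (e / (2 * `|y|))%R.
have k0 : (0 < k)%R by rewrite divr_gt0// mulr_gt0.
have := he (k *: y)%R; rewrite -ball_normE /= sub0r normrN normrZ gtr0_norm//.
rewrite f0 sub0r normrN fZ normrM (gtr0_norm k0).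
have -> : (k * `|y| = e / 2)%R by rewrite /k; field; rewrite gt_eqF.
move=> /(_ ltac:(lra)) h; rewrite -(ler_pM2l k0); apply: le_trans (ltW h) _.
by rewrite /k le_eqVlt; apply/orP; left; apply/eqP; field; rewrite !gt_eqF.
Qed.

(** The approximations [Y k] take finitely many values and converge to [X] in mean. Their means
    satisfy [|m k - m l| <= E|Y k - Y l|], hence form a Cauchy sequence, and the limit is the mean
    of [X] because each continuous functional passes to the limit by dominated convergence. *)
Lemma pettis_mean_exists (B : completeNormedModType R) (X : Om -> B) :
  separable_space B -> borel_measurable X -> \int[P]_w (`|X w|)%:E < +oo ->
  exists x, pettis_mean P X x.
Proof.
move=> sB bX iX; have [c dens] := dense_sequence sB.
pose Y k := nearest c k \o X.
have bY k : borel_measurable (Y k) by exact: borel_measurable_nearest.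
have mD (Z Z' : Om -> B) : borel_measurable Z -> borel_measurable Z' ->
    measurable_fun setT (fun w => (`|Z w - Z' w|)%:E).
  move=> bZ bZ'; apply/measurable_EFinP; apply: borel_measurable_norm.
  exact: borel_measurableB.
have mX : measurable_fun setT (fun w => (`|X w|)%:E).
  by apply/measurable_EFinP; exact: borel_measurable_norm.
have inX : P.-integrable setT (fun w => (`|X w|)%:E).
  by apply/integrableP; split=> //; under eq_integral do rewrite gee0_abs//.
have [_ _ cvD] : [/\ P.-integrable setT (fun _ : Om => 0%:E),
    [sequence \int[P]_w (`|(`|X w - Y n w|)%:E - 0|)]_n @ \oo --> 0 &
    [sequence \int[P]_w (`|X w - Y n w|)%:E]_n @ \oo --> \int[P]_w 0%:E].
  apply: (@dominated_convergence _ _ _ P setT measurableT (fun n w => (`|X w - Y n w|)%:E)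
     (fun _ => 0%:E) (fun w => (`|X w|)%:E)) => //.
  - by move=> n; exact: mD.
  - by apply: aeW => w _; exact: nearest_cvg.
  - by apply: aeW => w n _; rewrite gee0_abs// lee_fin nearest_le.
rewrite integral0 in cvD.
have mean k : {m | pettis_mean P (Y k) m}.
  apply: cid; have [m pm] := pettis_mean_nearest c k sB bX measurableT.
  exists m; move: pm; congr (pettis_mean P _ _); apply/funext => w.
  by rewrite indicT scale1r.
pose m k := projT1 (mean k).
have pm k : pettis_mean P (Y k) (m k) by exact: (projT2 (mean k)).
pose e k := \int[P]_w (`|X w - Y k w|)%:E.
have dm k l : (`|m k - m l|)%:E <= e k + e l.
  have pkl := pettis_meanD (pm l) (pettis_meanN (pm k)).
  have := @pettis_mean_norm_le _ _ _ 0%R (borel_measurableB sB (bY l) (bY k)) sB pkl.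
  rewrite sub0r opprB => h; apply: le_trans h _.
  rewrite -ge0_integralD//; [|exact: mD|exact: mD].
  apply: ge0_le_integral => //.
  - apply/measurable_EFinP; apply: borel_measurable_norm.
    by apply: borel_measurableB; [|exact: borel_measurable_cst|exact: borel_measurableB].
  - by apply: emeasurable_funD; exact: mD.
  - move=> w _; rewrite -EFinD lee_fin sub0r opprB.
    rewrite (_ : Y k w - Y l w = (X w - Y l w) - (X w - Y k w))%R; last first.
      by rewrite opprB [RHS]addrC subrKA.
    by rewrite (le_trans (ler_normB _ _))// addrC.
have e_cvg : e @ \oo --> 0 by exact: cvD.
have cm : cvg (m @ \oo).
  apply/cauchy_cvgP/cauchy_exP => eps eps0.
  have e20 : (0 < eps / 2)%R by rewrite divr_gt0.
  have [k _ hk] : \forall k \near \oo, e k < (eps / 2)%:E.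
    have /fine_cvgP[fe /cvgrPdist_lt /(_ _ e20)] := e_cvg.
    move=> h; near=> k; rewrite -[e k]fineK; last by near: k.
    rewrite lte_fin; apply: le_lt_trans (ler_norm _) _.
    by rewrite -normrN -sub0r; near: k.
  exists (m k); exists k => // l /= kl; rewrite -ball_normE /= -lte_fin.
  apply: le_lt_trans (dm k l) _; rewrite (splitr eps) EFinD.
  by apply: lteD; apply: hk => /=.
exists (lim (m @ \oo)) => f fD fZ fc.
have [C C0 fC] := linear_continuous_bound fD fZ fc.
have bfX (Z : Om -> B) : borel_measurable Z -> measurable_fun setT (fun w => (f (Z w))%:E).
  by move=> bZ; apply/measurable_EFinP/borel_measurable_real; exact: (borel_measurable_continuous fc).
have fB u v : f (u - v)%R = (f u - f v)%R by rewrite fD -(scaleN1r v) fZ mulN1r.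
have [i1 _ cvf] : [/\ P.-integrable setT (fun w => (f (X w))%:E),
    [sequence \int[P]_w (`|(f (Y n w))%:E - (f (X w))%:E|)]_n @ \oo --> 0 &
    [sequence \int[P]_w (f (Y n w))%:E]_n @ \oo --> \int[P]_w (f (X w))%:E].
  (* The bound is [|f (Y n)| <= C |Y n|], with [|Y n| <= |X| + |X - Y n| <= 2 |X|]. *)
  apply: (@dominated_convergence _ _ _ P setT measurableT (fun n w => (f (Y n w))%:E)
     (fun w => (f (X w))%:E) (fun w => (C * 2)%:E * (`|X w|)%:E)) => //.
  - by move=> n; exact: bfX.
  - exact: bfX.
  - apply: aeW => w _; apply/fine_cvgP; split; first exact: nearW.
    apply: (@cvg_comp _ _ _ (fun n => Y n w) f _ (nbhs (X w))); last exact: fc.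
    have /fine_cvgP[_ /cvgrPdist_lt h] := nearest_cvg (X w) dens.
    apply/cvgrPdist_lt => r r0; have := h r r0; apply: filterS => n /=.
    by rewrite sub0r normrN normr_id.
  - exact: integrableZl.
  - apply: aeW => w n _; rewrite -EFinM abse_EFin lee_fin -mulrA.
    apply: le_trans (fC _) _; rewrite ler_pM2l//.
    rewrite (_ : Y n w = X w - (X w - Y n w))%R; last by rewrite opprB addrC subrK.
    apply: le_trans (ler_normB _ _) _; rewrite mulr_natl mulr2n lerD2l.
    exact: nearest_le.
split => //; apply/esym; apply: cvg_unique cvf => //=.
rewrite (_ : (fun _ => _) = (fun n => (f (m n))%:E)); last first.
  by apply/funext => n /=; have [_ ->] := pm n f fD fZ fc.
apply/fine_cvgP; split; first exact: nearW.
apply: (@cvg_comp _ _ _ m f _ (nbhs (lim (m @ \oo)))) => //; exact: fc.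
Unshelve. all: by end_near. Qed.

End pettis.

(** * Laws of independent families *)

(** Generators of the product sigma-algebra on sequences: a map into it is measurable as soon as its
    coordinates are, and a law on it is fixed by finitely many coordinates at a time. *)
Definition cylinder (J : Type) (T : topologicalType) : set (set (J -> T)) :=
  [set C | exists j A, borel_set A /\ C = [set x | A (x j)]].

(** The form of [independent_seq] for any index type, so that it also covers two copies indexed by
    [bool * nat]; at [J = nat] the two are the same by conversion. *)
Definition indep_fam {d} (Om : measurableType d) (R : realType)
  (P : probability Om R) (T : topologicalType) (J : eqType) (U : J -> Om -> T) : Prop :=
  forall (s : seq J) (A : J -> set T), uniq s ->
    (forall j, borel_set (A j)) ->
    P (\bigcap_(j in [set` s]) (U j @^-1` A j)) =
    (\big[*%E/1%E]_(j <- s) P (U j @^-1` A j))%E.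

Section path_space.
Context {R : realType} {B : normedModType R}.
Local Notation path J := (g_sigma_algebraType (@cylinder J B)).

Lemma measurable_path {d} {Om : measurableType d} (J : Type) (U : Om -> path J) :
  (forall j, borel_measurable (fun w => U w j)) -> measurable_fun setT U.
Proof.
move=> bU; apply: (@measurability _ _ _ _ setT U (@cylinder J B)) => // _ [_ [j [A [bA ->]]] <-].
by rewrite setTI; apply: (bU j _ bA).
Qed.

Lemma borel_measurable_coord (J : Type) (j : J) :
  borel_measurable (fun x : path J => x j).
Proof. by move=> A bA; apply: sub_sigma_algebra; exists j, A. Qed.

Lemma borel_setT (T : topologicalType) : borel_set [set: T].
Proof. by apply: borel_open; exact: openT. Qed.

Lemma borel_setI (A A' : set B) :
  borel_set A -> borel_set A' -> borel_set (A `&` A').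
Proof.
exact: (@measurableI _ (g_sigma_algebraType [set U : set B | open U])).
Qed.

(** Independence and equal marginals give equal measure to all finite intersections of coordinate
    events. These form a pi-system generating the path sigma-algebra, so uniqueness of finite
    measures applies. *)
Lemma law_eq {d1 d2} {Om1 : measurableType d1} {Om2 : measurableType d2}
    (P1 : probability Om1 R) (P2 : probability Om2 R) (J : eqType)
    (U1 : J -> Om1 -> B) (U2 : J -> Om2 -> B) (C : set (path J)) :
  (forall j, borel_measurable (U1 j)) -> (forall j, borel_measurable (U2 j)) ->
  indep_fam P1 U1 -> indep_fam P2 U2 ->
  (forall j A, borel_set A -> P1 (U1 j @^-1` A) = P2 (U2 j @^-1` A)) ->
  measurable C ->
  P1 [set w | C (U1 ^~ w)] = P2 [set w | C (U2 ^~ w)].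
Proof.
move=> b1 b2 i1 i2 eqm mC.
pose Pi := [set D : set (path J) | exists s A, [/\ uniq s, (forall j, borel_set (A j)) &
   D = \bigcap_(j in [set` s]) [set x | A j (x j)]]].
have sPi : @measurable _ (path J) = <<s Pi >>.
  apply/seteqP; split; apply: smallest_sub; try exact: smallest_sigma_algebra.
    move=> _ [j [A [bA ->]]]; apply: sub_sigma_algebra; exists [:: j], (fun=> A); split => //.
    apply/seteqP; split => x /= h; first by move=> i; rewrite /= inE => /eqP ->.
    by apply: (h j); rewrite /= inE.
  move=> _ [s [A [us bA ->]]]; apply: (@fin_bigcap_measurable _ (path J)).
    exact: finite_seq.
  by move=> j _; exact: borel_measurable_coord.
have m1 : measurable_fun setT ((fun w => U1 ^~ w) : Om1 -> path J) by exact: measurable_path.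
have m2 : measurable_fun setT ((fun w => U2 ^~ w) : Om2 -> path J) by exact: measurable_path.
pose V1 : {mfun Om1 >-> path J} := HB.pack (fun w => U1 ^~ w) (isMeasurableFun.Build _ _ _ _ _ m1).
pose V2 : {mfun Om2 >-> path J} := HB.pack (fun w => U2 ^~ w) (isMeasurableFun.Build _ _ _ _ _ m2).
apply: (@measure_unique _ R (path J) Pi (fun=> setT) sPi _ _ _
  (distribution P1 V1) (distribution P2 V2)) => //.
- move=> _ _ [s [A [us bA ->]]] [s' [A' [us' bA' ->]]].
  (* Indices constrained by only one of the two events receive [setT] from the other. *)
  exists (undup (s ++ s')), (fun j => (if j \in s then A j else setT) `&` (if j \in s' then A' j else setT)).
  split; first exact: undup_uniq.
    by move=> j; apply: borel_setI; case: ifP => // _; exact: borel_setT.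
  apply/seteqP; split => x /=.
    by move=> [h h'] j /= _; split; case: ifPn => // js; [exact: h|exact: h'].
  move=> h; split => j /= js.
    by have [] := h j; rewrite /= ?mem_undup ?mem_cat js.
  by have [] := h j; rewrite /= ?mem_undup ?mem_cat js ?orbT.
- by move=> _; exists [::], (fun=> setT); split => //; [move=> _; exact: borel_setT|apply/seteqP; split].
- by apply/seteqP; split => // x _; exists 0%N.
- move=> _ [s [A [us bA ->]]]; have := i1 s A us bA; have := i2 s A us bA.
  by rewrite (eq_bigr _ (fun j _ => esym (eqm j _ (bA j)))) => <-.
- by move=> _; rewrite -ge0_fin_numE// fin_num_measure.
Qed.

(** The left inverse [h] keeps distinct indices distinct and carries the sets [A] back along [g]. *)
Lemma indep_fam_reindex {d} {Om : measurableType d} (P : probability Om R)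
    (J J' : eqType) (U : J -> Om -> B) (g : J' -> J) (h : J -> J') :
  cancel g h -> indep_fam P U -> indep_fam P (U \o g).
Proof.
move=> gK iU s A us bA.
have := iU (map g s) (A \o h); rewrite map_inj_uniq; last exact: can_inj gK.
move=> /(_ us (fun j => bA (h j))); rewrite big_map /=.
rewrite (_ : \bigcap_(j in [set` map g s]) _ = \bigcap_(j in [set` s]) ((U \o g) j @^-1` A j)).
  by move=> ->; apply: eq_bigr => j _; rewrite gK.
apply/seteqP; split => w h' j /= js.
  by have := h' (g j); rewrite /= gK; apply; exact: map_f.
by move: js => /mapP[i si ->]; rewrite /= gK; exact: h'.
Qed.

(** The boolean names the copy: [false] reads the first sample point, [true] the second. *)
Definition two_copies {d} {Om : measurableType d} (J : Type) (U : J -> Om -> B)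
  (p : bool * J) (z : Om * Om) : B := U p.2 (if p.1 then z.2 else z.1).

Lemma borel_measurable_two_copies {d} {Om : measurableType d} (J : Type) (U : J -> Om -> B) p :
  (forall j, borel_measurable (U j)) -> borel_measurable (two_copies U p).
Proof.
move=> bU; case: p => -[] j.
  exact: (borel_measurable_comp (@measurable_snd _ _ Om Om)).
exact: (borel_measurable_comp (@measurable_fst _ _ Om Om)).
Qed.

Lemma two_copies_marginal {d} {Om : measurableType d} (P : probability Om R) (J : Type)
    (U : J -> Om -> B) p A : (forall j, borel_measurable (U j)) -> borel_set A ->
  (P \x P)%E (two_copies U p @^-1` A) = P (U p.2 @^-1` A).
Proof.
move=> bU bA; have mUA : measurable (U p.2 @^-1` A) by exact: bU.
case: p mUA => -[] j /= mUA.
  rewrite (_ : _ @^-1` _ = setT `*` (U j @^-1` A)); last by apply/seteqP; split => // z [].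
  by rewrite [LHS]product_measure1E// -[RHS]mul1e; congr (_ * _)%E; exact: probability_setT.
rewrite (_ : _ @^-1` _ = (U j @^-1` A) `*` setT); last by apply/seteqP; split => // z [].
by rewrite [LHS]product_measure1E// -[RHS]mule1; congr (_ * _)%E; exact: probability_setT.
Qed.

Lemma two_copies_indep {d} {Om : measurableType d} (P : probability Om R) (J : eqType)
    (U : J -> Om -> B) : (forall j, borel_measurable (U j)) ->
  indep_fam P U -> indep_fam (P \x P)%E (two_copies U).
Proof.
move=> bU iU s A us bA.
pose s_ e := [seq p.2 | p <- s & p.1 == e].
have us_ e : uniq (s_ e).
  rewrite map_inj_in_uniq ?filter_uniq// => -[e1 j1] [e2 j2].
  by rewrite !mem_filter /= => /andP[/eqP -> _] /andP[/eqP -> _] ->.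
have mem_s e j : (j \in s_ e) = ((e, j) \in s).
  apply/mapP/idP => [[[e' j'] + ->]|js].
    by rewrite mem_filter /= => /andP[/eqP ->].
  by exists (e, j) => //; rewrite mem_filter /= eqxx.
pose Q e := \bigcap_(j in [set` s_ e]) (U j @^-1` A (e, j)).
have mQ e : measurable (Q e).
  by apply: fin_bigcap_measurable; [exact: finite_seq|move=> j _; exact: bU].
rewrite (_ : \bigcap_(j in _) _ = Q false `*` Q true); last first.
  apply/seteqP; split => [z h|z [h0 h1] [e j] /= js].
    split => j /=; rewrite mem_s => js; first exact: (h (false, j)).
    exact: (h (true, j)).
  by case: e js => js; [apply: (h1 j)|apply: (h0 j)]; rewrite /= mem_s.
have PQ e : P (Q e) = (\big[*%E/1%E]_(j <- s_ e) P (U j @^-1` A (e, j)))%E.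
  exact: (iU (s_ e) (fun j => A (e, j)) (us_ e) (fun j => bA (e, j))).
transitivity (P (Q false) * P (Q true))%E; first exact: product_measure1E.
rewrite !PQ.
rewrite !big_map !big_filter [RHS](bigID (fun p => p.1 == false)) /=.
congr (_ * _)%E.
  apply: eq_bigr => -[e j] /= /eqP ->.
  by rewrite (@two_copies_marginal _ _ _ _ _ (false, j)).
rewrite [LHS](eq_bigl (fun p => p.1 != false)); last by move=> -[[]].
apply: eq_bigr => -[[] j] //= _.
by rewrite (@two_copies_marginal _ _ _ _ _ (true, j)).
Qed.

(** * Independence of complementary blocks of coordinates *)

Section laws.
Context {d} {Om : measurableType d} (P : probability Om R).

(** Taking the coordinates in [K] from one copy and the others from a second copy does not change
    the law of the family. In the new family [C] depends on the first sample point and [D] on the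
    second, so the joint event is a rectangle and its measure factors. *)
Lemma block_indep (J : eqType) (U : J -> Om -> B) (K : pred J) (C D : set (path J)) :
  (forall j, borel_measurable (U j)) -> indep_fam P U ->
  measurable C -> measurable D ->
  (forall x y, (forall j, K j -> x j = y j) -> C x -> C y) ->
  (forall x y, (forall j, ~~ K j -> x j = y j) -> D x -> D y) ->
  P [set w | C (U ^~ w) /\ D (U ^~ w)] = (P [set w | C (U ^~ w)] * P [set w | D (U ^~ w)])%E.
Proof.
move=> bU iU mC mD CK DK.
pose g j := (~~ K j, j).
have iW := indep_fam_reindex (fun j => erefl : snd (g j) = j) (two_copies_indep bU iU).
have mpre (E : set (path J)) : measurable E -> measurable [set w | E (U ^~ w)].
  move=> mE; rewrite -[X in measurable X]setTI.
  by have := @measurable_path _ _ _ (fun w => U ^~ w) bU measurableT E mE.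
have := @law_eq _ _ _ _ P (P \x P)%E _ U (two_copies U \o g) (C `&` D) bU _ iU iW.
move=> ->; last first.
- exact: measurableI.
- by move=> j A bA; rewrite /= two_copies_marginal.
- by move=> j; exact: borel_measurable_two_copies.
rewrite -[RHS]product_measure1E; [|exact: mpre|exact: mpre].
congr ((P \x P)%E _); apply/seteqP; split => -[w w'] /= [Cw Dw]; split.
- by apply: CK Cw => j Kj; rewrite /two_copies /= Kj.
- by apply: DK Dw => j Kj; rewrite /two_copies /= Kj.
- by apply: CK Cw => j Kj; rewrite /two_copies /= Kj.
- by apply: DK Dw => j Kj; rewrite /two_copies /= Kj.
Qed.

End laws.

(** * Sign symmetry of the difference of two copies *)

Section symmetrization.
Context {d} {Om : measurableType d} (P : probability Om R).

Definition flip (I : pred nat) (x : nat -> B) : nat -> B :=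
  fun i => if I i then - x i else x i.

Definition symmetrized (V : nat -> Om -> B) (n : nat) (z : Om * Om) : B :=
  V n z.1 - V n z.2.

Let diff (x : path (bool * nat)) : path nat := fun i => x (false, i) - x (true, i).

Let measurable_diff : separable_space B -> measurable_fun setT diff.
Proof.
move=> sB; apply: measurable_path => j.
by apply: borel_measurableB => //; exact: borel_measurable_coord.
Qed.

Let measurable_diff_preimage (C : set (path nat)) : separable_space B -> measurable C ->
  measurable (diff @^-1` C).
Proof. by move=> sB mC; rewrite -[X in measurable X]setTI; exact: measurable_diff. Qed.

(** Exchanging the two copies at the indices in [I] is an involution of [bool * nat] that preserves
    the law of the doubled family, and it changes the sign of exactly those differences. *)
Lemma symmetrized_flip (V : nat -> Om -> B) (I : pred nat) (C : set (path nat)) :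
  separable_space B -> (forall n, borel_measurable (V n)) -> indep_fam P V -> measurable C ->
  (P \x P)%E [set z | C (symmetrized V ^~ z)] =
  (P \x P)%E [set z | C (flip I (symmetrized V ^~ z))].
Proof.
move=> sB bV iV mC.
pose g (p : bool * nat) := (if I p.2 then ~~ p.1 else p.1, p.2).
have gK : cancel g g by move=> [e i]; rewrite /g /=; case: (I i); rewrite ?negbK.
have i2 := two_copies_indep bV iV.
have b2 p := borel_measurable_two_copies p bV.
have := @law_eq _ _ _ _ (P \x P)%E (P \x P)%E _ (two_copies V) (two_copies V \o g)
  (diff @^-1` C) b2 (fun p => b2 (g p)) i2 (indep_fam_reindex gK i2) _
  (measurable_diff_preimage sB mC).
rewrite /= => ->; last by move=> [e i] A bA; rewrite /= !two_copies_marginal.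
congr ((P \x P)%E _); apply/seteqP; split => z /=; congr C; apply/funext => i;
  by rewrite /diff /two_copies /flip /g /symmetrized /=; case: (I i); rewrite /= ?opprB.
Qed.

Lemma symmetrized_block (V : nat -> Om -> B) (K : pred nat) (C D : set (path nat)) :
  separable_space B -> (forall n, borel_measurable (V n)) -> indep_fam P V ->
  measurable C -> measurable D ->
  (forall x y, (forall j, K j -> x j = y j) -> C x -> C y) ->
  (forall x y, (forall j, ~~ K j -> x j = y j) -> D x -> D y) ->
  (P \x P)%E [set z | C (symmetrized V ^~ z) /\ D (symmetrized V ^~ z)] =
  ((P \x P)%E [set z | C (symmetrized V ^~ z)] * (P \x P)%E [set z | D (symmetrized V ^~ z)])%E.
Proof.
move=> sB bV iV mC mD CK DK.
apply: (@block_indep _ _ (P \x P)%E _ (two_copies V) (fun p => K p.2)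
  (diff @^-1` C) (diff @^-1` D)).
- by move=> p; exact: borel_measurable_two_copies.
- exact: two_copies_indep.
- exact: measurable_diff_preimage.
- exact: measurable_diff_preimage.
- by move=> x y xy; apply: CK => j Kj; rewrite /diff !xy.
- by move=> x y xy; apply: DK => j Kj; rewrite /diff !xy.
Qed.

End symmetrization.

End path_space.

(** * First passage decompositions *)

Section first_passage.
Context {d} {T : measurableType d} {R : realType} (mu : {measure set T -> \bar R}).
Local Open Scope ereal_scope.

(** The common last step of the maximal inequalities: an estimate made separately at each first
    passage index is summed over the disjoint events [C n]. *)
Lemma measure_bigcup_le_scale (A C : nat -> set T) (c : R) : (0 <= c)%R ->
  (forall n, measurable (A n)) -> (forall n, measurable (C n)) -> trivIset setT C ->
  (forall n, mu (A n) <= c%:E * mu (C n)) ->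
  mu (\bigcup_n A n) <= c%:E * mu (\bigcup_n C n).
Proof.
move=> c0 mA mC tC AC.
have -> : mu (\bigcup_n C n) = \sum_(n <oo) mu (C n).
  by rewrite measure_bigcup//; apply: eq_eseriesl => n; rewrite in_setT.
rewrite -nneseriesZl//.
apply: le_trans (measure_sigma_subadditive _ mA (bigcupT_measurable _ mA) _) _ => //.
by apply: lee_nneseries => // n _; exact: AC.
Qed.

Lemma measurable_seqDU (S : nat -> set T) n :
  (forall n, measurable (S n)) -> measurable (seqDU S n).
Proof. by move=> mS; apply: measurableD => //; exact: bigsetU_measurable. Qed.

(** Reads [seqDU S n] as the event that [n] is the first index at which [S] occurs. *)
Lemma seqDUP (S : nat -> set T) n x :
  seqDU S n x <-> S n x /\ forall i, (i < n)%N -> ~ S i x.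
Proof.
rewrite /seqDU -bigcup_mkord; split => -[Sn h]; split => //.
  by move=> i ni Si; apply: h; exists i.
by move=> [i /= ni Si]; exact: (h i).
Qed.

Lemma measurable_gte (f : T -> \bar R) (t : \bar R) : measurable_fun setT f ->
  measurable [set x | t < f x].
Proof. by move=> mf; rewrite -[X in measurable X]setTI; exact: emeasurable_fun_o_infty. Qed.

End first_passage.

(** * The weighted norm of a sequence *)

Section weighted_norm.
Context {R : realType} {B : normedModType R} (a : nat -> R).
Hypothesis ha0 : forall n, 0 <= a n.
Local Open Scope ereal_scope.
Local Notation path := (g_sigma_algebraType (@cylinder nat B)).

(** Extended values make it total on sequences, so tail inequalities for it need no prior
    finiteness. *)
Definition ell (x : nat -> B) : \bar R :=
  \sum_(n <oo) (a n * `|\sum_(i < n.+1) x i|)%:E.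

Definition restr (I : pred nat) (x : nat -> B) : nat -> B :=
  fun i => if I i then x i else 0%R.

Let term_ge0 (x : B) n : 0 <= (a n * `|x|)%:E.
Proof. by rewrite lee_fin mulr_ge0. Qed.

Lemma ell_ge0 x : 0 <= ell x.
Proof. exact: nneseries_ge0. Qed.

Lemma ellD x y : ell (fun i => x i + y i)%R <= ell x + ell y.
Proof.
rewrite -nneseriesD//; apply: lee_nneseries => // n _.
rewrite -EFinD lee_fin -mulrDr ler_wpM2l// big_split /=; exact: ler_normD.
Qed.

Lemma ellN x : ell (fun i => - x i)%R = ell x.
Proof. by apply: eq_eseriesr => n _; rewrite sumrN normrN. Qed.

Lemma ell_double x : ell (fun i => x i + x i)%R = ell x + ell x.
Proof.
rewrite -nneseriesD//; apply: eq_eseriesr => n _.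
rewrite -EFinD big_split /= -mulrDr; congr (_ * _)%:E.
by rewrite -mulr2n normrMn mulr2n.
Qed.

Lemma ell0 : ell (fun=> 0%R) = 0.
Proof. by apply: eseries0 => n _ _; rewrite big1// normr0 mulr0. Qed.

(** Twice the restriction to [I] is the sum of [x] and its reflection outside [I]. Hence when the
    restriction exceeds a level, [x] or its reflection exceeds it too. *)
Lemma ell_restr_flip (I : pred nat) x :
  ell (restr I x) + ell (restr I x) <= ell x + ell (flip (predC I) x).
Proof.
rewrite -ell_double; apply: le_trans (ellD _ _).
rewrite le_eqVlt; apply/orP; left; apply/eqP; congr ell; apply/funext => i.
by rewrite /restr /flip /=; case: (I i); rewrite //= subrr addr0.
Qed.

Lemma ell_split (I : pred nat) x :
  ell x <= ell (restr I x) + ell (restr (predC I) x).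
Proof.
apply: le_trans (ellD _ _).
rewrite le_eqVlt; apply/orP; left; apply/eqP; congr ell; apply/funext => i.
by rewrite /restr /=; case: (I i); rewrite /= ?addr0 ?add0r.
Qed.

(** The first [n] terms of the series see only coordinates up to [n], so they are bounded by [ell]
    of a prefix. *)
Lemma ell_le_prefix x t :
  (forall n, ell (restr (fun i => (i <= n)%N) x) <= t) -> ell x <= t.
Proof.
move=> h; apply: lime_le; first exact: is_cvg_nneseries.
apply: nearW => n; apply: le_trans (h n).
apply: le_trans (nneseries_lim_ge n _); last by [].
rewrite big_nat [X in _ <= X]big_nat; apply: lee_sum => k /andP[_ kn].
rewrite le_eqVlt; apply/orP; left; apply/eqP.
congr (_ * `|_|)%:E; apply: eq_bigr => i _; rewrite /restr.
by rewrite (leq_trans (ltnW (ltn_ord i)))// ; exact: ltn_ord.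
Qed.

Lemma measurable_restr (I : pred nat) : measurable_fun setT (restr I : path -> path).
Proof.
apply: measurable_path => j; rewrite /restr; case: (I j).
  exact: borel_measurable_coord.
exact: borel_measurable_cst.
Qed.

Lemma measurable_flip (I : pred nat) : measurable_fun setT (flip I : path -> path).
Proof.
apply: measurable_path => j; rewrite /flip; case: (I j); last exact: borel_measurable_coord.
rewrite (_ : (fun _ => _) = (fun w : path => (-1) *: w j)%R).
  by apply: borel_measurableZ; exact: borel_measurable_coord.
by apply/funext => w; rewrite scaleN1r.
Qed.

Lemma measurable_ell : separable_space B -> measurable_fun setT (ell : path -> \bar R).
Proof.
move=> sB.
rewrite (_ : ell = fun x => \sum_(n <oo | n \in xpredT)
    (a n * `|\sum_(i < n.+1) x i|)%:E)%E; last first.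
  by apply/funext => x; apply: eq_eseriesl.
apply: ge0_emeasurable_sum => // n _; apply/measurable_EFinP; apply: measurable_funM => //.
apply: borel_measurable_norm; apply: (@borel_measurable_sum _ _ _ _ (fun i (x : path) => x i)) => // i.
exact: borel_measurable_coord.
Qed.

Hypothesis hsum : \sum_(n <oo) (a n)%:E < +oo.

Lemma tailsumE n : (tailsum a n)%:E = \sum_(n <= k <oo) (a k)%:E.
Proof.
have ca : cvgn (series a) by exact: nnseries_is_cvg.
rewrite /tailsum -EFin_lim; last by rewrite is_cvg_series_restrict.
by congr (limn _); apply/funext => m /=; rewrite sumEFin.
Qed.

Lemma tailsum_ge0 n : (0 <= tailsum a n)%R.
Proof. by rewrite -lee_fin tailsumE; apply: nneseries_ge0 => k _ _; rewrite lee_fin. Qed.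

(** The partial sums of a sequence living at [n] vanish before [n] and equal [x n] from [n] on,
    which collects the weights [a k] with [k >= n]. *)
Lemma ell_single x n :
  ell (restr (pred1 n) x) = (tailsum a n * `|x n|)%:E.
Proof.
rewrite EFinM tailsumE muleC -nneseriesZl; last by move=> k _; rewrite lee_fin.
rewrite /ell (nneseries_split 0 n)// add0n big_nat big1 ?add0e; last first.
  move=> k /andP[_ kn]; rewrite big1 ?normr0 ?mulr0// => i _.
  by rewrite /restr /= ltn_eqF// (leq_trans _ kn)//.
rewrite eseries_cond [RHS]eseries_cond.
apply: eq_eseriesr => k /andP[_ nk]; rewrite -EFinM mulrC; congr (`|_| * _)%:E.
rewrite (bigD1 (Ordinal (nk : (n < k.+1)%N)))//= /restr /= eqxx big1 ?addr0// => i ni.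
by rewrite ifF//; apply: contraNF ni => /eqP ni; apply/eqP/val_inj.
Qed.

(** The triangle inequality in each partial sum, followed by exchanging the order of summation over
    pairs [i <= n]. This is the bound [L <= M]. *)
Lemma ell_le_sum x : ell x <= \sum_(n <oo) (tailsum a n * `|x n|)%:E.
Proof.
pose f n i := if (i <= n)%N then (a n * `|x i|)%:E else 0.
have f0 n i : 0 <= f n i by rewrite /f; case: ifP.
apply: (@le_trans _ _ (\sum_(n <oo) \sum_(i <oo) f n i)).
  apply: lee_nneseries => // n _; apply: le_trans (nneseries_lim_ge n.+1 _) => //.
  rewrite big_mkord (eq_bigr (fun i : 'I_n.+1 => (a n * `|x i|)%:E)).
    by rewrite sumEFin lee_fin -mulr_sumr ler_wpM2l//; exact: ler_norm_sum.
  by move=> i _; rewrite /f -ltnS ltn_ord.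
rewrite nneseries_interchange//; apply: lee_nneseries; first by move=> i _ _; exact: nneseries_ge0.
move=> i _; rewrite EFinM tailsumE muleC -nneseriesZl; last by move=> k _; rewrite lee_fin.
rewrite [leRHS]eseries_cond [leRHS]eseries_mkcond le_eqVlt; apply/orP; left; apply/eqP.
by apply: eq_eseriesr => n _; rewrite /f /=; case: ifP => // _; rewrite -EFinM mulrC.
Qed.

End weighted_norm.

(** * The inequalities of Levy and Hoffmann-Jorgensen *)

Section symmetric_sums.
Context {R : realType} {B : normedModType R} (a : nat -> R).
Hypothesis ha0 : forall n, 0 <= a n.
Hypothesis sB : separable_space B.
Local Open Scope ereal_scope.
Local Notation path := (g_sigma_algebraType (@cylinder nat B)).
(** The law of the symmetrized sequence enters only through invariance under reflections and
    independence of complementary blocks. *)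
Variable mu : probability path R.
Hypothesis mu_flip : forall (I : pred nat) (C : set path), measurable C ->
  mu C = mu [set x | C (flip I x)].
Hypothesis mu_block : forall (K : pred nat) (C D : set path), measurable C -> measurable D ->
  (forall x y, (forall j, K j -> x j = y j) -> C x -> C y) ->
  (forall x y, (forall j, ~~ K j -> x j = y j) -> D x -> D y) ->
  mu (C `&` D) = mu C * mu D.

Local Notation exceeds t := [set x : path | t%:E < ell a x].
Local Notation exceeds_on I t := [set x : path | t%:E < ell a (restr I x)].

Let measurable_exceeds t : measurable (exceeds t).
Proof. by apply: measurable_gte; exact: measurable_ell. Qed.

Let measurable_exceeds_on I t : measurable (exceeds_on I t).
Proof.
apply: measurable_gte; apply: (measurableT_comp (measurable_ell ha0 sB)).
exact: measurable_restr.
Qed.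

(* Reflecting the coordinates outside I_n at the first n where the bound is
   exceeded leaves that event invariant. *)
Lemma levy_inequality (I : nat -> pred nat) (t : R) :
  (forall i n, (i <= n)%N ->
     (forall j, I i j -> I n j) \/ (forall j, I i j -> ~~ I n j)) ->
  mu (\bigcup_n (exceeds_on (I n) t)) <= 2%:E * mu (exceeds t).
Proof.
move=> nest; pose S n := exceeds_on (I n) t.
have mS n : measurable (S n) by exact: measurable_exceeds_on.
have S_flip i n x : (i <= n)%N -> S i (flip (predC (I n)) x) <-> S i x.
  move=> /nest[sub|dis]; rewrite /S /=.
    suff -> : restr (I i) (flip (predC (I n)) x) = restr (I i) x by [].
    apply/funext => j; rewrite /restr /flip /=; case: ifP => // /sub ->.
    by [].
  suff -> : ell a (restr (I i) (flip (predC (I n)) x)) = ell a (restr (I i) x) by [].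
  rewrite -[RHS]ellN; congr ell; apply/funext => j; rewrite /restr /flip /=.
  by case: ifP => [/dis ->//|]; rewrite oppr0.
have D_flip n x : seqDU S n (flip (predC (I n)) x) <-> seqDU S n x.
  rewrite !seqDUP S_flip//; split => -[Sn h]; split => // i ni.
    by move=> /(S_flip _ _ _ (ltnW ni)); exact: h.
  by move=> /(S_flip _ _ _ (ltnW ni)); exact: h.
have mD n : measurable (seqDU S n) by exact: measurable_seqDU.
rewrite seqDU_bigcup_eq.
apply: (@le_trans _ _ (2%:E * mu (\bigcup_n (seqDU S n `&` exceeds t)))); last first.
  rewrite lee_pmul2l// le_measure ?inE//.
    by apply: bigcupT_measurable => n; exact: measurableI.
  by move=> x [n _ []].
apply: measure_bigcup_le_scale => //.
- by move=> n; exact: measurableI.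
- by apply: trivIset_setIr; exact: trivIset_seqDU.
move=> n; set E := seqDU S n `&` exceeds t.
have mE : measurable E by exact: measurableI.
have mE' : measurable [set x : path | E (flip (predC (I n)) x)].
  by rewrite -[X in measurable X]setTI; exact: measurable_flip.
apply: (@le_trans _ _ (mu (E `|` [set x : path | E (flip (predC (I n)) x)]))).
  rewrite le_measure ?inE//; first exact: measurableU.
  (* If neither [x] nor its reflection exceeded [t], [ell_restr_flip] would bound twice the
     restricted value by [2 t], against the first passage at [n]. *)
  move=> x Dx; have [tx|xt] := ltP t%:E (ell a x); first by left.
  right; split; first by apply/D_flip.
  rewrite /= ltNge; apply/negP => fxt.
  have [Sx _] := (seqDUP _ _ _).1 Dx.
  have := ell_restr_flip ha0 (I n) x; apply/negP; rewrite -ltNge.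
  by apply: le_lt_trans (leeD xt fxt) _; apply: lteD.
apply: le_trans (measureU2 _ _ _) _ => //.
apply: (@le_trans _ _ (mu E + mu E)).
  by rewrite leeD2l// le_eqVlt; apply/orP; left; apply/eqP/esym; exact: mu_flip.
by rewrite (_ : 2 = 1 + 1)%R// EFinD ge0_muleDl// mul1e.
Qed.

Hypothesis hsum : \sum_(n <oo) (a n)%:E < +oo.

(** Singletons are equal or disjoint, the case for which [levy_inequality] allows disjoint index
    sets; the nested case serves [levy_prefix]. *)
Lemma levy_coordinates (t : R) :
  mu [set x : path | exists n, (t < tailsum a n * `|x n|)%R] <= 2%:E * mu (exceeds t).
Proof.
apply: le_trans (levy_inequality (I := fun n => pred1 n) t _).
  rewrite le_eqVlt; apply/orP; left; apply/eqP; congr (mu _).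
  apply/seteqP; split => x /= [n]; first by move=> h; exists n => //; rewrite /= ell_single.
  by move=> _ /=; rewrite ell_single// lte_fin => h; exists n.
move=> i n _; have [->|ni] := eqVneq i n; [by left|right].
by move=> j /eqP ->.
Qed.

Lemma levy_prefix (t : R) :
  mu (\bigcup_n exceeds_on (fun i => (i <= n)%N) t) <= 2%:E * mu (exceeds t).
Proof.
apply: levy_inequality => i n ni; left => j /= ji; exact: leq_trans ni.
Qed.

Lemma levy_single (I : pred nat) (t : R) :
  mu (exceeds_on I t) <= 2%:E * mu (exceeds t).
Proof.
apply: le_trans (levy_inequality (I := fun=> I) t _); last by left.
rewrite le_measure ?inE//; first by apply: bigcupT_measurable => n.
by move=> x h; exists 0%N.
Qed.

(** Let [n] be the first index whose prefix exceeds [t]. If no coordinate exceeds [s], the prefix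
    through [n] is at most [t + s], so the part after [n] must exceed [t]. That part is independent
    of the first passage event, and Levy's inequality costs a factor 2 for each of the two. *)
Lemma hoffmann_jorgensen (t s : R) : (0 <= t)%R -> (0 <= s)%R ->
  mu (exceeds (2 * t + s)%R) <=
  4%:E * mu (exceeds t) * mu (exceeds t) + mu [set x : path | exists n, (s < tailsum a n * `|x n|)%R].
Proof.
move=> t0 s0; pose S n := exceeds_on (fun i => (i <= n)%N) t.
pose G n := exceeds_on (predC (fun i => (i <= n)%N)) t.
have mS n : measurable (S n) by exact: measurable_exceeds_on.
have mD n : measurable (seqDU S n) by exact: measurable_seqDU.
set N := [set x : path | exists n, (s < _)%R].
have mN : measurable N.
  rewrite (_ : N = \bigcup_n exceeds_on (pred1 n) s).
    by apply: bigcupT_measurable => n; exact: measurable_exceeds_on.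
  apply/seteqP; split => x /= [n]; first by move=> h; exists n => //; rewrite /= ell_single.
  by move=> _ /=; rewrite ell_single// lte_fin => h; exists n.
have mDG n : measurable (seqDU S n `&` G n) by apply: measurableI => //; exact: measurable_exceeds_on.
apply: (@le_trans _ _ (mu ((\bigcup_n (seqDU S n `&` G n)) `|` N))).
  rewrite le_measure ?inE//.
    by apply: measurableU => //; exact: bigcupT_measurable.
  move=> x /= ex; have [Nx|nN] := pselect (N x); [by right|left].
  have [n _ Dn] : (\bigcup_n S n) x.
    apply: contrapT => nS; move: ex; apply/negP; rewrite -leNgt.
    apply: (@le_trans _ _ t%:E); last by rewrite lee_fin; lra.
    apply: ell_le_prefix => // n; rewrite leNgt; apply/negP => h.
    by apply: nS; exists n.
  have : (\bigcup_n seqDU S n) x by rewrite -seqDU_bigcup_eq; exists n.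
  move=> {n Dn} [n _ Dn]; exists n => //; split => //.
  have [Sn pre] := (seqDUP _ _ _).1 Dn.
  have le1 : ell a (restr (fun i => (i <= n)%N) x) <= (t + s)%:E.
    apply: (@le_trans _ _ (ell a (restr (fun i => (i < n)%N) x) + ell a (restr (pred1 n) x))).
      apply: le_trans (ellD ha0 _ _).
      rewrite le_eqVlt; apply/orP; left; apply/eqP; congr ell; apply/funext => i.
      rewrite /restr /= leq_eqVlt; case: eqVneq => [->|_] /=; first by rewrite ltnn add0r.
      by rewrite addr0.
    rewrite EFinD leeD//.
      (* At passage index 0 the preceding prefix is empty; otherwise minimality of the index bounds
         it by [t]. *)
      case: n pre {Dn Sn} => [_|n pre].
        by rewrite (_ : restr _ _ = fun=> 0%R) ?ell0// lee_fin.
      by rewrite leNgt; apply/negP; exact: (pre n).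
    by rewrite ell_single// lee_fin leNgt; apply/negP => h; apply: nN; exists n.
  rewrite /G /= ltNge; apply/negP => Gt.
  move: ex; apply/negP; rewrite -leNgt.
  apply: le_trans (ell_split ha0 (fun i => (i <= n)%N) x) _.
  apply: le_trans (leeD le1 Gt) _; rewrite -EFinD lee_fin; lra.
apply: le_trans (measureU2 _ _ _) _ => //; first exact: bigcupT_measurable.
rewrite leeD2r//.
have fin : mu (exceeds t) \is a fin_num by exact: fin_num_measure.
(* After factoring by independence, [levy_single] bounds the remainder uniformly in [n], so the
   first passage events can be summed with one constant. *)
apply: (@le_trans _ _ ((2 * fine (mu (exceeds t)))%:E * mu (\bigcup_n seqDU S n))).
  apply: measure_bigcup_le_scale => //; first by rewrite mulr_ge0// fine_ge0.
  move=> n; rewrite muleC EFinM fineK//.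
  apply: (@le_trans _ _ (mu (seqDU S n) * mu (G n))); last first.
    by rewrite lee_wpmul2l//; exact: levy_single.
  rewrite le_eqVlt; apply/orP; left; apply/eqP.
  apply: (mu_block (K := fun i => (i <= n)%N)) => //.
  - exact: measurable_exceeds_on.
  - move=> x y xy /seqDUP[Sx pre]; apply/seqDUP.
    have E i : (i <= n)%N -> S i y = S i x.
      move=> ni; rewrite /S /=; congr (is_true (_ < ell a _)); apply/funext => j.
      by rewrite /restr; case: ifP => // ji; rewrite xy//; exact: leq_trans ni.
    by split; [rewrite E|move=> i ni; rewrite E ?(ltnW ni)//; exact: pre].
  - move=> x y xy; rewrite /G /=; suff -> : restr (predC (leq^~ n)) x = restr (predC (leq^~ n)) y by [].
    by apply/funext => j; rewrite /restr /=; case: ifP => // h; rewrite xy.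
rewrite EFinM fineK// -seqDU_bigcup_eq.
rewrite (_ : 4 = 2 * 2)%R; last by ring.
rewrite EFinM -[leRHS]muleA [leRHS]muleACA lee_wpmul2l//; last exact: levy_prefix.
by rewrite mule_ge0.
Qed.

End symmetric_sums.

(** * Integrals and tails along a geometric sequence *)

Section geometric_tails.
Context {d} {Om : measurableType d} {R : realType} (P : probability Om R).
Local Open Scope ereal_scope.

(** A discrete substitute for the integral of the tail; it is comparable with the expectation, up to
    constants and the additive term [t0]. *)
Definition gtail (Y : Om -> \bar R) (t0 : R) : \bar R :=
  \sum_(k <oo) (3 ^+ k * t0)%:E * P [set w | (3 ^+ k * t0)%:E < Y w].

Section one_variable.
Variables (Y : Om -> \bar R) (t0 : R).
Hypothesis mY : measurable_fun setT Y.
Hypothesis Y0 : forall w, 0 <= Y w.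
Hypothesis t00 : (0 < t0)%R.

Let c k : R := (3 ^+ k * t0)%R.
Let c_gt0 k : (0 < c k)%R. Proof. by rewrite mulr_gt0// exprn_gt0. Qed.
Let A k := [set w | (c k)%:E < Y w].
Let g k w : \bar R := (c k)%:E * (\1_(A k) w)%:E.
Let mA k : measurable (A k). Proof. exact: measurable_gte. Qed.
Let g0 k w : 0 <= g k w.
Proof. by rewrite mule_ge0// lee_fin// ltW. Qed.
Let g_le k w : g k w <= (c k)%:E.
Proof.
by rewrite /g indicE; case: (w \in A k); rewrite ?mule1// mule0 lee_fin ltW.
Qed.
Let mg k : measurable_fun setT (g k).
Proof. by apply: measurable_funeM; apply/measurable_EFinP; exact: measurable_indic. Qed.

Let int_g : \int[P]_w (\sum_(k <oo) g k w) = gtail Y t0.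
Proof.
rewrite integral_nneseries//; apply: eq_eseriesr => k _.
rewrite ge0_integralZl//; last 2 first.
- by apply/measurable_EFinP; exact: measurable_indic.
- by rewrite lee_fin ltW.
by rewrite integral_indic// setIT.
Qed.

Let m_sum_g : measurable_fun setT (fun w => \sum_(k <oo) g k w).
Proof.
rewrite (_ : (fun _ => _) = fun w => \sum_(k <oo | k \in xpredT) g k w).
  exact: ge0_emeasurable_sum.
by apply/funext => w; exact: eq_eseriesl.
Qed.

(** Pointwise, the levels lying below [Y w] form a geometric sum, which is at most 3/2 of its
    largest term. *)
Lemma gtail_le_integral : gtail Y t0 <= (3 / 2)%:E * \int[P]_w Y w.
Proof.
rewrite -ge0_integralZl//.
rewrite -int_g; apply: ge0_le_integral => //.
- by move=> w _; exact: nneseries_ge0.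
- exact: measurable_funeM.
move=> w _; apply: lime_le; first exact: is_cvg_nneseries.
apply: nearW => K.
have gsum n : \sum_(0 <= k < n.+1) g k w <= ((3 / 2) * c n)%:E.
  elim: n => [|n ih].
    rewrite big_nat1; apply: le_trans (g_le 0 w) _.
    by rewrite lee_fin /c expr0; move: t00; lra.
  rewrite big_nat_recr//=; apply: le_trans (leeD ih (g_le n.+1 w)) _.
  by rewrite -EFinD lee_fin /c exprS; have := c_gt0 n; rewrite /c; lra.
elim: K => [|K ih]; first by rewrite big_nil mule_ge0// lee_fin.
have [h|h] := boolP (w \in A K).
  apply: le_trans (gsum K) _; rewrite EFinM lee_wpmul2l ?lee_fin//.
  by move: h => /set_mem /ltW.
by rewrite big_nat_recr//= [X in _ + X]/g indicE (negbTE h) mule0 adde0.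
Qed.

(** Pointwise, [Y w] is at most [t0] or at most three times the largest level below it. *)
Lemma integral_le_gtail : \int[P]_w Y w <= t0%:E + 3%:E * gtail Y t0.
Proof.
rewrite -int_g -ge0_integralZl//; last by move=> w _; exact: nneseries_ge0.
rewrite [X in X + _](_ : t0%:E = \int[P]_w t0%:E); last first.
  apply/esym; transitivity (t0%:E * P setT); first exact: integral_cst.
  by rewrite probability_setT mule1.
rewrite -ge0_integralD//; last 3 first.
- by move=> w _; rewrite lee_fin ltW.
- by move=> w _; rewrite mule_ge0//; exact: nneseries_ge0.
- exact: measurable_funeM.
apply: ge0_le_integral => //.
- by apply: emeasurable_funD => //; exact: measurable_funeM.
move=> w _; rewrite leNgt; apply/negP; set r := (X in X < _) => rY.
have s0 : 0 <= \sum_(k <oo) g k w by exact: nneseries_ge0.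
(* If [r < Y w], a level at most [r] lies below [Y w] and so contributes to the sum, which puts the
   next level below [r] as well. All levels would then be bounded by [r], which is finite. *)
have cr n : (c n)%:E <= r.
  elim: n => [|n ih]; first by rewrite /c expr0 mul1r leeDl// mule_ge0.
  apply: (@le_trans _ _ (3%:E * g n w)).
    rewrite /g indicE mem_set; last exact: le_lt_trans rY.
    by rewrite mule1 -EFinM lee_fin /c exprS mulrA.
  apply: (@le_trans _ _ (3%:E * \sum_(k <oo) g k w)); last by rewrite leeDr// lee_fin ltW.
  rewrite lee_wpmul2l//; apply: le_trans (nneseries_lim_ge n.+1 _) => //.
  by rewrite big_nat_recr//= leeDr// sume_ge0.
have rfin : r \is a fin_num.
  rewrite ge0_fin_numE; first by apply: lt_le_trans rY _; exact: leey.
  by apply: adde_ge0; [rewrite lee_fin ltW|exact: mule_ge0].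
pose n := (Num.bound (fine r / t0)).
have := cr n; rewrite -[r]fineK// lee_fin /c.
apply/negP; rewrite -ltNge -ltr_pdivrMr//.
have r0 : (0 <= fine r / t0)%R.
  apply: divr_ge0; last exact: ltW.
  by apply: fine_ge0; apply: adde_ge0; [rewrite lee_fin ltW|exact: mule_ge0].
apply: lt_le_trans (archi_boundP r0) _; rewrite -/n -natrX ler_nat.
by apply: ltnW; exact: ltn_expl.
Qed.

End one_variable.

Lemma ae_fin_tail (Y : Om -> \bar R) (e : R) : measurable_fun setT Y ->
  {ae P, forall w, Y w < +oo} -> (0 < e)%R ->
  exists2 t : R, (0 < t)%R & P [set w | t%:E < Y w] <= e%:E.
Proof.
move=> mY Yfin e0.
pose F n := [set w | (n.+1%:R)%:E < Y w].
have mF n : measurable (F n) by exact: measurable_gte.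
have F0 : P (\bigcap_n F n) = 0.
  apply/eqP; rewrite eq_le measure_ge0 andbT.
  have [N [mN N0 sN]] := Yfin.
  rewrite -N0 le_measure ?inE//; first exact: bigcapT_measurable.
  move=> w Fw; apply: sN => /= Yw.
  have [//|Yp] := leP (Y w) 0.
    by have /lt_le_trans /[apply] := Fw 0%N I; rewrite lte_fin ltr10.
  have fY : Y w \is a fin_num by rewrite ge0_fin_numE// ltW.
  have := Fw (Num.bound (fine (Y w))) I; rewrite /F /= -[Y w]fineK// lte_fin.
  apply/negP; rewrite -leNgt.
  have fp : (0 <= fine (Y w))%R by rewrite fine_ge0// ltW.
  by apply: le_trans (ltW (archi_boundP fp)) _; rewrite ler_nat.
have cv : (P \o F) @ \oo --> P (\bigcap_n F n).
  apply: nonincreasing_cvg_mu => //; first by rewrite -ge0_fin_numE// fin_num_measure.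
    exact: bigcapT_measurable.
  move=> m n mn; apply/subsetPset => w; rewrite /F /=; apply: le_lt_trans.
  by rewrite lee_fin ler_nat ltnS.
rewrite F0 in cv.
have /fine_cvgP[_ /cvgrPdist_lt /(_ e e0)] := cv.
move=> [n _ /(_ n (leqnn n))]; rewrite /= sub0r normrN => h.
exists n.+1%:R => //; rewrite -[leLHS]fineK; last exact: (fin_num_measure P _ (mF n)).
rewrite lee_fin; by apply: le_trans (ler_norm _) (ltW h).
Qed.

Lemma ae_fin_of_tail (Y : Om -> \bar R) : measurable_fun setT Y ->
  (forall e, (0 < e)%R -> exists t : R, P [set w | t%:E < Y w] <= e%:E) ->
  {ae P, forall w, Y w < +oo}.
Proof.
move=> mY h; exists [set w | Y w = +oo]; split.
- by rewrite -[X in measurable X]setTI; exact: (mY measurableT [set +oo]).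
- apply/eqP; rewrite eq_le measure_ge0 andbT; apply/lee_addgt0Pr => e e0.
  rewrite add0e; have [t ht] := h e e0; apply: le_trans ht.
  rewrite le_measure ?inE//; last by move=> w /= ->; exact: ltry.
    by rewrite -[X in measurable X]setTI; exact: (mY measurableT [set +oo]).
  exact: measurable_gte.
- by move=> w /=; rewrite ltey => /negP; rewrite negbK => /eqP.
Qed.

(** Once the tail of [Y] is small, its square is a small multiple of it and the hypothesis becomes a
    linear recursion along the levels [3 ^+ k * t0], summable when the tails of [Z] are. *)
Lemma integral_fin_of_quadratic_tail (Y Z : Om -> \bar R) :
  measurable_fun setT Y -> measurable_fun setT Z ->
  (forall w, 0 <= Y w) -> (forall w, 0 <= Z w) ->
  {ae P, forall w, Y w < +oo} -> \int[P]_w Z w < +oo ->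
  (forall t : R, (0 < t)%R -> P [set w | (3 * t)%:E < Y w] <=
     4%:E * P [set w | t%:E < Y w] * P [set w | t%:E < Y w] + P [set w | t%:E < Z w]) ->
  \int[P]_w Y w < +oo.
Proof.
move=> mY mZ Y0 Z0 Yfin Zfin hj.
(* With [p k <= 1/24] the term [4 p k ^ 2] is at most [p k / 6]; the weight ratio 3 turns 1/6 into
   1/2. *)
have e0 : (0 < 24^-1 :> R)%R by rewrite invr_gt0.
have [t0 t00 ht0] := ae_fin_tail mY Yfin e0.
pose p k := fine (P [set w | (3 ^+ k * t0)%:E < Y w]).
pose q k := fine (P [set w | (3 ^+ k * t0)%:E < Z w]).
have pE k : P [set w | (3 ^+ k * t0)%:E < Y w] = (p k)%:E.
  by rewrite fineK// fin_num_measure//; exact: measurable_gte.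
have qE k : P [set w | (3 ^+ k * t0)%:E < Z w] = (q k)%:E.
  by rewrite fineK// fin_num_measure//; exact: measurable_gte.
have p0 k : (0 <= p k)%R by rewrite fine_ge0.
have q0 k : (0 <= q k)%R by rewrite fine_ge0.
have c0 k : (0 < 3 ^+ k :> R)%R by rewrite exprn_gt0.
have pk k : (p k <= 24^-1)%R.
  rewrite -lee_fin -pE; apply: le_trans ht0; rewrite le_measure ?inE//.
  - exact: measurable_gte.
  - exact: measurable_gte.
  move=> w /=; apply: le_lt_trans; rewrite lee_fin.
  by apply: ler_peMl; [exact: ltW|apply: exprn_ege1; rewrite ler1n].
have step k : (p k.+1 <= 6^-1 * p k + q k)%R.
  have ct : (0 < 3 ^+ k * t0)%R by rewrite mulr_gt0.
  have := hj _ ct; rewrite mulrA -exprS !pE qE -!EFinM -EFinD lee_fin.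
  move=> /le_trans; apply; rewrite lerD2r ler_wpM2r//.
  by have := pk k; lra.
have gZ := gtail_le_integral mZ Z0 t00.
have gZfin : gtail Z t0 < +oo.
  by apply: le_lt_trans gZ _; rewrite lte_mul_pinfty// ?lee_fin.
pose D := fine (gtail Z t0).
have gZ0 : 0 <= gtail Z t0.
  by apply: nneseries_ge0 => k _ _; rewrite mule_ge0// lee_fin mulr_ge0// ltW.
have qD K : (\sum_(0 <= k < K) 3 ^+ k * t0 * q k <= D)%R.
  rewrite -lee_fin /D fineK; last by rewrite ge0_fin_numE.
  rewrite -sumEFin; under eq_bigr do rewrite EFinM -qE.
  by apply: nneseries_lim_ge => k _ _; rewrite mule_ge0// lee_fin mulr_ge0// ltW.
(* Partial sums [S] satisfy [S (K + 1) <= t0 p 0 + S K / 2 + 3 D], and the bound is the fixed point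
   of this recursion. Finite sums allow the absorption before convergence is known. *)
have pD K : (\sum_(0 <= k < K) 3 ^+ k * t0 * p k <= 2 * (t0 * p 0 + 3 * D))%R.
  have D0 : (0 <= D)%R by rewrite fine_ge0.
  have tp : (0 <= t0 * p 0)%R by rewrite mulr_ge0// ltW.
  elim: K => [|K ih]; first by rewrite big_nil; lra.
  rewrite big_nat_recl//= expr0 mul1r.
  apply: (@le_trans _ _ (t0 * p 0 + \sum_(0 <= k < K)
      (2^-1 * (3 ^+ k * t0 * p k) + 3 * (3 ^+ k * t0 * q k))))%R.
    rewrite lerD2l; apply: ler_sum => k _.
    have := ler_wpM2l (ltW (mulr_gt0 (c0 k.+1) t00)) (step k).
    move=> /le_trans; apply; rewrite exprS le_eqVlt; apply/orP; left; apply/eqP.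
    by field.
  rewrite big_split /= -!mulr_sumr; have := qD K; lra.
apply: le_lt_trans (integral_le_gtail mY Y0 t00) _.
have : gtail Y t0 <= (2 * (t0 * p 0 + 3 * D))%:E.
  apply: lime_le.
    by apply: is_cvg_nneseries => k _ _; rewrite mule_ge0// lee_fin mulr_ge0// ltW.
  apply: nearW => K; under eq_bigr do rewrite pE -EFinM; rewrite sumEFin lee_fin.
  exact: pD.
move=> h; rewrite lte_add_pinfty ?ltry// lte_mul_pinfty//.
exact: le_lt_trans h (ltry _).
Qed.

End geometric_tails.

(** * Comparison of the tails of N and L *)

Section coordinate_sup.
Context {R : realType} {B : normedModType R} (a : nat -> R).
Local Open Scope ereal_scope.
Local Notation path := (g_sigma_algebraType (@cylinder nat B)).

Definition coordinate_sup (x : nat -> B) : \bar R :=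
  ereal_sup (range (fun n => (tailsum a n * `|x n|)%:E)).

Lemma lt_coordinate_sup (t : R) x :
  (t%:E < coordinate_sup x) <-> exists n, (t < tailsum a n * `|x n|)%R.
Proof.
split; last first.
  move=> [n tn]; apply: (@lt_le_trans _ _ (tailsum a n * `|x n|)%:E).
    by rewrite lte_fin.
  by apply: ereal_sup_ubound; exists n.
move=> h; apply: contrapT => nex; move: h; apply/negP; rewrite -leNgt.
apply: ge_ereal_sup => _ [n _ <-]; rewrite lee_fin leNgt; apply/negP => tn.
by apply: nex; exists n.
Qed.

Lemma measurable_coordinate (n : nat) (t : R) :
  measurable [set x : path | (t < tailsum a n * `|x n|)%R].
Proof.
have mf : measurable_fun setT (fun x : path => (tailsum a n * `|x n|)%R).
  by apply: measurable_funM => //; apply: borel_measurable_norm; exact: borel_measurable_coord.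
rewrite (_ : mkset _ = (fun x : path => (tailsum a n * `|x n|)%R) @^-1` `]t, +oo[).
  by rewrite -[X in measurable X]setTI; exact: mf.
by apply/seteqP; split => x /=; rewrite in_itv /= andbT.
Qed.

Lemma measurable_coordinate_sup : measurable_fun setT (coordinate_sup : path -> \bar R).
Proof.
apply: (measurability (@ErealGenOInfty.G R)) => [|_ [_ [r ->] <-]].
  exact: ErealGenOInfty.measurableE.
rewrite setTI (_ : _ @^-1` _ = \bigcup_n [set x : path | (r < tailsum a n * `|x n|)%R]).
  by apply: bigcupT_measurable => n; exact: measurable_coordinate.
apply/seteqP; split => x /=; rewrite in_itv /= ?andbT.
  by rewrite lt_coordinate_sup => -[n h]; exists n.
by move=> [n _ h]; rewrite lt_coordinate_sup; exists n.
Qed.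

End coordinate_sup.

Section tail_comparison.
Context {R : realType} {d} {Om : measurableType d} (P : probability Om R).
Context {B : normedModType R} (V : nat -> Om -> B) (a : nat -> R).
Hypothesis sB : separable_space B.
Hypothesis bV : forall n, borel_measurable (V n).
Hypothesis iV : indep_fam P V.
Hypothesis ha0 : forall n, 0 <= a n.
Hypothesis hsum : (\sum_(n <oo) (a n)%:E < +oo)%E.
Local Open Scope ereal_scope.
Local Notation path := (g_sigma_algebraType (@cylinder nat B)).
Local Notation b := (tailsum a).
Local Notation N := (fun w => coordinate_sup a (V ^~ w)).
Local Notation L := (fun w => ell a (V ^~ w)).
Local Notation PP := (P \x P).
Local Notation X := (symmetrized V).
Local Notation Gamma t := (\sum_(n <oo) P [set w | (t < b n * `|V n w|)%R]).

Let measurable_V : measurable_fun setT ((fun w => V ^~ w) : Om -> path).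
Proof. exact: measurable_path. Qed.

Lemma measurable_N : measurable_fun setT N.
Proof. exact: (measurableT_comp (@measurable_coordinate_sup _ _ a) measurable_V). Qed.

Lemma measurable_L : measurable_fun setT L.
Proof. exact: (measurableT_comp (measurable_ell ha0 sB) measurable_V). Qed.

Lemma measurable_symmetrized : measurable_fun setT ((fun z => X ^~ z) : (Om * Om)%type -> path).
Proof.
apply: measurable_path => j; apply: borel_measurableB => //.
- exact: (borel_measurable_comp (@measurable_fst _ _ Om Om)).
- exact: (borel_measurable_comp (@measurable_snd _ _ Om Om)).
Qed.

Let Xpath : {mfun (Om * Om)%type >-> path} :=
  HB.pack (fun z => X ^~ z) (isMeasurableFun.Build _ _ _ _ _ measurable_symmetrized).

Let mu : probability path R := distribution PP Xpath.

Let mu_flip (I : pred nat) (C : set path) : measurable C ->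
  mu C = mu [set x : path | C (flip I x)].
Proof. exact: symmetrized_flip. Qed.

Let mu_block (K : pred nat) (C D : set path) : measurable C -> measurable D ->
  (forall x y, (forall j, K j -> x j = y j) -> C x -> C y) ->
  (forall x y, (forall j, ~~ K j -> x j = y j) -> D x -> D y) ->
  mu (C `&` D) = mu C * mu D.
Proof. exact: symmetrized_block. Qed.

Lemma symmetrized_levy (t : R) :
  PP [set z | t%:E < coordinate_sup a (X ^~ z)] <=
  2%:E * PP [set z | t%:E < ell a (X ^~ z)].
Proof.
have := levy_coordinates ha0 sB mu_flip hsum t.
rewrite (_ : [set x : path | exists n, _] = [set x : path | t%:E < coordinate_sup a x]); first by [].
by apply/seteqP; split => x /=; rewrite lt_coordinate_sup.
Qed.

Lemma symmetrized_hoffmann_jorgensen (t : R) : (0 <= t)%R ->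
  PP [set z | (3 * t)%:E < ell a (X ^~ z)] <=
  4%:E * PP [set z | t%:E < ell a (X ^~ z)] * PP [set z | t%:E < ell a (X ^~ z)] +
  PP [set z | t%:E < coordinate_sup a (X ^~ z)].
Proof.
move=> t0; have := hoffmann_jorgensen ha0 sB mu_flip mu_block hsum t0 t0.
rewrite (_ : 2 * t + t = 3 * t)%R; last by ring.
rewrite (_ : [set x : path | exists n, _] = [set x : path | t%:E < coordinate_sup a x]); first by [].
by apply/seteqP; split => x /=; rewrite lt_coordinate_sup.
Qed.

Lemma ell_symmetrized_le z : ell a (X ^~ z) <= L z.1 + L z.2.
Proof. by rewrite -[X in _ + X]ellN; exact: ellD. Qed.

Lemma probability_setXT (A : set Om) : measurable A -> PP (A `*` setT) = P A.
Proof.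
move=> mA; transitivity (P A * P setT); first exact: product_measure1E.
by rewrite probability_setT mule1.
Qed.

Lemma probability_setTX (A : set Om) : measurable A -> PP (setT `*` A) = P A.
Proof.
move=> mA; transitivity (P setT * P A); first exact: product_measure1E.
by rewrite probability_setT mul1e.
Qed.

Lemma symmetrized_tail_le (t : R) :
  PP [set z | t%:E < ell a (X ^~ z)] <= 2%:E * P [set w | (t / 2)%:E < L w].
Proof.
pose E := [set w | (t / 2)%:E < L w].
have mE : measurable E by apply: measurable_gte; exact: measurable_L.
apply: (@le_trans _ _ (PP (E `*` setT `|` setT `*` E))).
  rewrite le_measure ?inE//.
  - apply: measurable_gte; exact: (measurableT_comp (measurable_ell ha0 sB) measurable_symmetrized).
  - by apply: measurableU; exact: measurableX.
  move=> z /= tz; have [h1|h1] := ltP (t / 2)%:E (L z.1); first by left.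
  have [h2|h2] := ltP (t / 2)%:E (L z.2); first by right.
  move: tz; rewrite ltNge => /negP; case.
  apply: le_trans (ell_symmetrized_le z) _; rewrite (splitr t) EFinD.
  exact: leeD.
apply: le_trans (measureU2 _ _ _) _; [exact: measurableX|exact: measurableX|].
rewrite (_ : 2 = 1 + 1)%R// EFinD ge0_muleDl// mul1e; apply: leeD.
  by rewrite [leLHS](probability_setXT mE).
by rewrite [leLHS](probability_setTX mE).
Qed.

(** At the first [n] where the first copy exceeds [t + c], the second copy stays within [c] with
    probability at least [delta], and then the difference exceeds [t]. *)
Lemma desymmetrization (c delta t : R) : (0 < delta)%R ->
  (forall n, delta%:E <= P [set w | (b n * `|V n w| <= c)%R]) ->
  P [set w | (t + c)%:E < N w] <= (delta^-1)%:E * PP [set z | t%:E < coordinate_sup a (X ^~ z)].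
Proof.
move=> d0 hd.
pose A n := [set w | (t + c < b n * `|V n w|)%R].
pose G n := [set w | (b n * `|V n w| <= c)%R].
have mA n : measurable (A n).
  by have := measurable_V measurableT (measurable_coordinate a n (t + c)); rewrite setTI.
have mG n : measurable (G n).
  have := measurable_V measurableT (measurableC (measurable_coordinate a n c)); rewrite setTI.
  rewrite (_ : _ @^-1` _ = G n)//.
  by apply/seteqP; split => w /=; rewrite /G /= leNgt => /negP.
have mD n : measurable (seqDU A n) by exact: measurable_seqDU.
apply: (@le_trans _ _ (PP (\bigcup_n (seqDU A n `*` setT)))).
  apply: (@le_trans _ _ (PP (\bigcup_n seqDU A n `*` setT))); last first.
    rewrite le_measure ?inE//.
    - by apply: measurableX => //; exact: bigcupT_measurable.
    - by apply: bigcupT_measurable => n; exact: measurableX.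
    by move=> z [[n _ h] _]; exists n.
  rewrite [leRHS]probability_setXT; last exact: bigcupT_measurable.
  rewrite -seqDU_bigcup_eq le_measure ?inE//.
  - by apply: measurable_gte; exact: measurable_N.
  - exact: bigcupT_measurable.
  by move=> w /lt_coordinate_sup[n h]; exists n.
apply: (@le_trans _ _ ((delta^-1)%:E * PP (\bigcup_n (seqDU A n `*` G n)))).
  apply: measure_bigcup_le_scale => //.
  - by rewrite invr_ge0 ltW.
  - by move=> n; exact: measurableX.
  - by move=> n; exact: measurableX.
  (* The rectangles are disjoint already through their first factors. *)
  - apply/trivIsetP => i j _ _ ij; apply/seteqP; split => // -[w w'] [[/= Di _] [Dj _]].
    have /trivIsetP/(_ i j I I ij) := @trivIset_seqDU _ A.
    by move=> /seteqP[/(_ w (conj Di Dj))].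
  move=> n; rewrite [leLHS]probability_setXT// [X in _ <= _ * X]product_measure1E//.
  rewrite muleCA -[leLHS]mule1 lee_wpmul2l//.
  rewrite (_ : 1 = (delta^-1)%:E * delta%:E); last by rewrite -EFinM mulVf// gt_eqF.
  apply: lee_wpmul2l; [by rewrite lee_fin invr_ge0 ltW|exact: hd].
rewrite lee_wpmul2l ?lee_fin ?invr_ge0 ?(ltW d0)// le_measure ?inE//.
- by apply: bigcupT_measurable => n; exact: measurableX.
- apply: measurable_gte.
  exact: (measurableT_comp (@measurable_coordinate_sup _ _ a) measurable_symmetrized).
move=> z [n _ [/seqDUP[An _] Gn]]; rewrite /= lt_coordinate_sup; exists n.
move: An Gn; rewrite /A /G /X /= => An Gn.
have bn := tailsum_ge0 ha0 hsum n.
have := ler_wpM2l bn (lerB_dist (V n z.1) (V n z.2)); rewrite mulrBr; lra.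
Qed.

(** The constant collects [1 / delta] from desymmetrization, 2 from Levy, and 2 from the fact that
    one of the copies of [L] must exceed [t / 2]. *)
Lemma N_tail_le_L_tail (c delta t : R) : (0 < delta)%R ->
  (forall n, delta%:E <= P [set w | (b n * `|V n w| <= c)%R]) ->
  P [set w | (t + c)%:E < N w] <= (4 / delta)%:E * P [set w | (t / 2)%:E < L w].
Proof.
move=> d0 hd; apply: le_trans (desymmetrization t d0 hd) _.
rewrite mulrC EFinM -muleA lee_wpmul2l ?lee_fin ?invr_ge0 ?(ltW d0)//.
apply: le_trans (symmetrized_levy t) _.
rewrite (_ : 4 = 2 * 2)%R; last by ring.
by rewrite EFinM -muleA lee_wpmul2l//; exact: symmetrized_tail_le.
Qed.

End tail_comparison.

(** * The tails of N and the sum Gamma *)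

Section layer_cake.
Context {R : realType} {d} {Om : measurableType d} (P : probability Om R).
Local Open Scope ereal_scope.
Local Notation leb := (@lebesgue_measure R).

Lemma measurable_tail_probability (f : Om -> R) : measurable_fun setT f ->
  measurable_fun setT (fun t : R => P [set w | (t < f w)%R]).
Proof.
move=> mf; pose X : {RV P >-> R} := HB.pack f (isMeasurableFun.Build _ _ _ _ _ mf).
rewrite (_ : (fun _ => _) = ccdf X); first exact: ccdf_measurable.
apply/funext => t; congr (P _); apply/seteqP; split => w /=;
  by rewrite in_itv /= andbT.
Qed.

Lemma tail_probability_fine (Y : Om -> \bar R) (t : R) : measurable_fun setT Y ->
  (forall w, 0 <= Y w) -> {ae P, forall w, Y w < +oo} ->
  P [set w | t%:E < Y w] = P [set w | (t < fine (Y w))%R].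
Proof.
move=> mY Y0 [Z [mZ Z0 sZ]].
have mf : measurable_fun setT (fine \o Y) by exact: measurableT_comp.
have m1 : measurable [set w | t%:E < Y w] by exact: measurable_gte.
have m2 : measurable [set w | (t < fine (Y w))%R].
  rewrite (_ : mkset _ = (fine \o Y) @^-1` `]t, +oo[).
    by rewrite -[X in measurable X]setTI; exact: mf.
  by apply/seteqP; split => w /=; rewrite in_itv /= andbT.
have eqZ w : ~ Z w -> (t%:E < Y w) = (t < fine (Y w))%R.
  move=> nZ; have Yw : Y w < +oo by apply: contrapT => h; apply: nZ; exact: sZ.
  by rewrite -lte_fin fineK// ge0_fin_numE.
have le A A' : measurable A -> measurable A' -> (forall w, ~ Z w -> A w -> A' w) -> P A <= P A'.
  move=> mA mA' h; apply: (@le_trans _ _ (P (A' `|` Z))).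
    rewrite le_measure ?inE//; first exact: measurableU.
    by move=> w Aw; have [|nZ] := pselect (Z w); [right|left; exact: h].
  apply: le_trans (measureU2 _ _ _) _ => //.
  by rewrite [X in _ + X](_ : _ = 0)// adde0.
apply/eqP; rewrite eq_le !le// => w nZ /=; by rewrite eqZ.
Qed.

(** Replacing [Y] by [fine \o Y], which changes it on a null set, reduces to the formula for real
    random variables. *)
Lemma layer_cake (Y : Om -> \bar R) : measurable_fun setT Y ->
  (forall w, 0 <= Y w) -> {ae P, forall w, Y w < +oo} ->
  \int[P]_w Y w = \int[leb]_(t in `[0%R, +oo[) P [set w | t%:E < Y w].
Proof.
move=> mY Y0 Yfin.
have mf : measurable_fun setT (fine \o Y) by exact: measurableT_comp.
pose X : {RV P >-> R} := HB.pack (fine \o Y) (isMeasurableFun.Build _ _ _ _ _ mf).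
have X0 w : (0 <= X w)%R by rewrite /X /= fine_ge0.
have := ge0_expectation_ccdf X0; rewrite unlock.
rewrite (_ : \int[P]_w (X w)%:E = \int[P]_w Y w); last first.
  apply: ge0_ae_eq_integral => //.
  - exact/measurable_EFinP.
  - by move=> w _; rewrite lee_fin.
  - by apply: filterS Yfin => w h _; rewrite /= fineK// ge0_fin_numE.
move=> ->; apply: eq_integral => t _; rewrite (tail_probability_fine _ mY)//.
congr (P _); apply/seteqP; split => w /=; by rewrite in_itv /= andbT.
Qed.

End layer_cake.

Section coordinate_tails.
Context {R : realType} {d} {Om : measurableType d} (P : probability Om R).
Context {B : normedModType R} (V : nat -> Om -> B) (a : nat -> R).
Hypothesis bV : forall n, borel_measurable (V n).
Hypothesis iV : indep_fam P V.
Hypothesis ha0 : forall n, 0 <= a n.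
Hypothesis hsum : (\sum_(n <oo) (a n)%:E < +oo)%E.
Local Open Scope ereal_scope.
Local Notation path := (g_sigma_algebraType (@cylinder nat B)).
Local Notation b := (tailsum a).
Local Notation leb := (@lebesgue_measure R).
Local Notation N := (fun w => coordinate_sup a (V ^~ w)).
Local Notation Gamma t := (\sum_(n <oo) P [set w | (t < b n * `|V n w|)%R]).

Let mN := measurable_N a bV.

Lemma coordinate_sup_ge0 (x : nat -> B) : 0 <= coordinate_sup a x.
Proof.
apply: le_trans (ereal_sup_ubound _); last by exists 0%N.
by rewrite lee_fin mulr_ge0//; exact: tailsum_ge0.
Qed.

Lemma measurable_coordinate_event (n : nat) (t : R) :
  measurable [set w | (t < b n * `|V n w|)%R].
Proof.
have := measurable_path bV measurableT (measurable_coordinate a n t).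
by rewrite setTI.
Qed.

Lemma Gamma_ge0 (t : R) : 0 <= Gamma t.
Proof. exact: nneseries_ge0. Qed.

Lemma N_tail_le_Gamma (t : R) : P [set w | t%:E < N w] <= Gamma t.
Proof.
apply: measure_sigma_subadditive.
- by move=> n; exact: measurable_coordinate_event.
- exact: measurable_gte.
by move=> w /lt_coordinate_sup[n h]; exists n.
Qed.

(* A_n and the event that no earlier A_i occurs are independent, so the first
   hitting probabilities dominate P(A_n) P(no A_i occurs). *)
Lemma Gamma_le_N_tail (t : R) :
  Gamma t * P [set w | N w <= t%:E] <= P [set w | t%:E < N w].
Proof.
pose A n := [set w | (t < b n * `|V n w|)%R].
pose D n := [set x : path | (t < b n * `|x n|)%R].
have mA n : measurable (A n) by exact: measurable_coordinate_event.
have mD n : measurable (D n) by exact: measurable_coordinate.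
have mU : measurable [set w | N w <= t%:E].
  rewrite (_ : mkset _ = ~` [set w | t%:E < N w]); first by apply: measurableC; exact: measurable_gte.
  by apply/seteqP; split => w /=; rewrite leNgt => /negP.
have -> : P [set w | t%:E < N w] = \sum_(n <oo) P (seqDU A n).
  rewrite (_ : [set w | _ < _] = \bigcup_n seqDU A n).
    rewrite measure_bigcup//; first by apply: eq_eseriesl => n; rewrite in_setT.
    by move=> n _; exact: measurable_seqDU.
  rewrite -seqDU_bigcup_eq; apply/seteqP; split => w /=.
    by move=> /lt_coordinate_sup[n h]; exists n.
  by move=> [n _ h]; apply/lt_coordinate_sup; exists n.
rewrite -[P [set w | N w <= _]]fineK; last exact: (fin_num_measure P _ mU).
rewrite muleC -nneseriesZl//; apply: lee_nneseries => [n _ _|n _].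
  by rewrite mule_ge0// lee_fin fine_ge0.
rewrite fineK; last exact: (fin_num_measure P _ mU).
pose C := ~` \big[setU/set0]_(i < n) D i.
have mC : measurable C by apply: measurableC; exact: bigsetU_measurable.
have CP (x : path) : C x <-> forall i, (i < n)%N -> ~ D i x.
  rewrite /C -bigcup_mkord; split => [h i ni Di|h [i /= ni Di]]; last exact: (h i).
  by apply: h; exists i.
have := @block_indep _ _ _ _ P _ V (fun i => (i < n)%N) C (D n) bV iV mC (mD n).
have -> : [set w | C (V^~ w) /\ D n (V^~ w)] = seqDU A n.
  by apply/seteqP; split => w /=; rewrite seqDUP CP => -[? ?].
move=> ->; last 2 first.
- by move=> x y xy /CP h; apply/CP => i ni; rewrite /D /= -xy//; exact: h.
- by move=> x y xy; rewrite /D /= xy// ltnn.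
rewrite lee_wpmul2r// le_measure ?inE//.
  by have := measurable_path bV measurableT mC; rewrite setTI.
move=> w /= Nw; apply/CP => i _ Di; move: Nw; rewrite leNgt => /negP; apply.
by apply/lt_coordinate_sup; exists i.
Qed.

Lemma half_le_probability_N (t : R) : P [set w | t%:E < N w] <= (1 / 2)%:E ->
  (1 / 2)%:E <= P [set w | N w <= t%:E].
Proof.
move=> h; have mT : measurable [set w | t%:E < N w] by exact: measurable_gte.
rewrite (_ : [set w | N w <= t%:E] = ~` [set w | t%:E < N w]); last first.
  by apply/seteqP; split => w /=; rewrite leNgt => /negP.
rewrite [leRHS]probability_setC//.
move: h; rewrite -[P _]fineK; last exact: (fin_num_measure P _ mT).
by rewrite -EFinB !lee_fin; lra.
Qed.

Lemma Gamma_le_double (t : R) : P [set w | t%:E < N w] <= (1 / 2)%:E ->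
  Gamma t <= 2%:E * P [set w | t%:E < N w].
Proof.
move=> /half_le_probability_N h.
apply: (@le_trans _ _ (2%:E * (Gamma t * (1 / 2)%:E))).
  by rewrite muleCA -EFinM mulrC divfK// mule1.
rewrite lee_wpmul2l//; apply: le_trans (Gamma_le_N_tail t).
by rewrite lee_wpmul2l// Gamma_ge0.
Qed.

(** Forward, any level with [P(N > t) <= 1/2] has finite [Gamma]. Backward is the first
    Borel-Cantelli lemma. *)
Lemma N_fin_iff :
  {ae P, forall w, N w < +oo} <-> ereal_inf [set Gamma r | r in [set r : R | (0 <= r)%R]] < +oo.
Proof.
split=> [Nfin|].
  have [t t0 ht] := ae_fin_tail mN Nfin (ltac:(lra) : (0 < 1 / 2 :> R)%R).
  apply: (@le_lt_trans _ _ (Gamma t)).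
    by apply: ereal_inf_lbound; exists t => //=; exact: ltW.
  apply: le_lt_trans (Gamma_le_double ht) _.
  by apply: le_lt_trans (lee_wpmul2l _ ht) _ => //; rewrite -EFinM ltry.
move=> /ereal_inf_lt [_ [r r0 <-] Gr].
have mA n := measurable_coordinate_event n r.
exists (lim_sup_set (fun n => [set w | (r < b n * `|V n w|)%R])); split.
- by apply: bigcap_measurable => //n _; apply: bigcup_measurable.
- exact: lim_sup_set_cvg0.
move=> w /= nN n _; apply: contrapT => nex; apply: nN.
(* From index [n] on every term is at most [r]; the finitely many earlier terms are bounded by their
   sum. *)
apply: (@le_lt_trans _ _ (r + \sum_(i < n) b i * `|V i w|)%:E); last exact: ltry.
have b0 i : (0 <= b i * `|V i w|)%R by rewrite mulr_ge0//; exact: tailsum_ge0.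
apply: ge_ereal_sup => _ [k _ <-]; rewrite lee_fin.
have [nk|kn] := leqP n k.
  have : (b k * `|V k w| <= r)%R by rewrite leNgt; apply/negP => h; apply: nex; exists k.
  by move=> /le_trans; apply; rewrite lerDl sumr_ge0.
rewrite (bigD1 (Ordinal kn))//= addrCA lerDl addr_ge0// sumr_ge0//.
Qed.

Lemma measurable_Gamma : measurable_fun setT (fun t : R => Gamma t).
Proof.
rewrite (_ : (fun _ => _) = fun t => \sum_(n <oo | n \in xpredT) P [set w | (t < b n * `|V n w|)%R]).
  apply: ge0_emeasurable_sum => // n _; apply: measurable_tail_probability.
  by apply: measurable_funM => //; exact: borel_measurable_norm.
by apply/funext => t; apply: eq_eseriesl.
Qed.

Lemma integral_N_fin_iff :
  \int[P]_w N w < +oo <->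
  exists r : R, (0 <= r)%R /\ \int[leb]_(t in [set t : R | (r <= t)%R]) Gamma t < +oo.
Proof.
have itvE (r : R) : [set t : R | (r <= t)%R] = `[r, +oo[%classic.
  by apply/seteqP; split => t /=; rewrite in_itv /= andbT.
have N0 w : 0 <= N w by exact: coordinate_sup_ge0.
have mp : {ae P, forall w, N w < +oo} ->
    measurable_fun setT (fun t : R => P [set w | t%:E < N w]).
  move=> Nfin; rewrite (_ : (fun _ => _) = fun t => P [set w | (t < fine (N w))%R]).
    by apply: measurable_tail_probability; exact: measurableT_comp.
  by apply/funext => t; exact: tail_probability_fine.
split=> [Nint|[r [r0]]].
  have Nfin : {ae P, forall w, N w < +oo}.
    have iN : P.-integrable setT N.
      by apply/integrableP; split => //; under eq_integral do rewrite gee0_abs//.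
    have := integrable_ae measurableT iN.
    by apply: filterS => w /(_ I); rewrite ge0_fin_numE.
  have [r r0 hr] := ae_fin_tail mN Nfin (ltac:(lra) : (0 < 1 / 2 :> R)%R).
  exists r; split; first exact: ltW.
  rewrite itvE; apply: (@le_lt_trans _ _ (\int[leb]_(t in `[r, +oo[) (2%:E * P [set w | t%:E < N w]))).
    apply: ge0_le_integral => //.
    - by move=> t _; exact: Gamma_ge0.
    - by apply: measurable_funS measurable_Gamma.
    - by apply: measurable_funeM; apply: measurable_funS (mp Nfin).
    move=> t /=; rewrite in_itv /= andbT => rt; apply: Gamma_le_double.
    apply: le_trans hr; rewrite le_measure ?inE//; try exact: measurable_gte.
    by move=> w /=; apply: le_lt_trans; rewrite lee_fin.
  rewrite ge0_integralZl//; last by apply: measurable_funS (mp Nfin).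
  rewrite lte_mul_pinfty//; apply: le_lt_trans Nint; rewrite (layer_cake mN N0 Nfin).
  apply: ge0_subset_integral => //; first by apply: measurable_funS (mp Nfin).
  by move=> t /=; rewrite !in_itv /= !andbT; apply: le_trans; exact: ltW.
rewrite itvE => Gint.
(* A function equal to [+oo] on a half-line has infinite integral; one finite value of [Gamma] gives
   almost sure finiteness of [N], which [layer_cake] requires. *)
have [t rt Gt] : exists2 t : R, (r <= t)%R & Gamma t < +oo.
  apply: contrapT => nex; move: Gint; apply/negP; rewrite -leNgt leye_eq.
  rewrite (eq_integral (cst +oo)); last first.
    move=> t; rewrite inE /= in_itv /= andbT => rt.
    by apply/eqP; rewrite -leye_eq leNgt; apply/negP => h; apply: nex; exists t.
  rewrite integral_cst//= lebesgue_measure_itv /= ltry.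
  by [].
have Nfin : {ae P, forall w, N w < +oo}.
  apply/N_fin_iff; apply: le_lt_trans Gt; apply: ereal_inf_lbound; exists t => //=.
  exact: le_trans rt.
rewrite (layer_cake mN N0 Nfin).
(* Below [r] the tail is bounded by 1 on a set of finite length, beyond [r] by [Gamma]. *)
rewrite (_ : `[0%R, +oo[%classic = `[0%R, r[ `|` `[r, +oo[); last first.
  apply/seteqP; split => x /=; rewrite !in_itv /= ?andbT.
    by move=> x0; have [h|h] := leP r x; [right|left; apply/andP; split].
  by move=> [/andP[]//|]; exact: le_trans.
rewrite ge0_integral_setU//; last 2 first.
- by apply: measurable_funS (mp Nfin) => //.
- apply/disj_setPS => x /=; rewrite !in_itv /= andbT => -[/andP[_ xr]].
  by rewrite leNgt xr.
rewrite lte_add_pinfty//.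
  apply: (@le_lt_trans _ _ (\int[leb]_(t in `[0%R, r[) (cst 1 t))).
    apply: ge0_le_integral => //; first by apply: measurable_funS (mp Nfin).
    by move=> x _; apply: probability_le1; exact: measurable_gte.
  rewrite integral_cst//= mul1e lebesgue_measure_itv /=; case: ifP => _; rewrite ?ltry//.
apply: le_lt_trans Gint; apply: ge0_le_integral => //.
- by apply: measurable_funS (mp Nfin).
- by apply: measurable_funS measurable_Gamma.
by move=> x _; exact: N_tail_le_Gamma.
Qed.

End coordinate_tails.

(** * Moments of N, L and the partial sums *)

Section moments.
Context {R : realType} {d} {Om : measurableType d} (P : probability Om R).
Local Open Scope ereal_scope.
Local Notation PP := (P \x P).

Lemma integral_pair_le (f : Om * Om -> \bar R) (g : Om -> \bar R) :
  measurable_fun setT f -> measurable_fun setT g ->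
  (forall z, 0 <= f z) -> (forall w, 0 <= g w) ->
  (forall z, f z <= g z.1 + g z.2) -> \int[PP]_z f z <= 2%:E * \int[P]_w g w.
Proof.
move=> mf mg f0 g0 fg.
have mg1 : measurable_fun setT (fun z : Om * Om => g z.1) by exact: measurableT_comp.
have mg2 : measurable_fun setT (fun z : Om * Om => g z.2) by exact: measurableT_comp.
apply: (@le_trans _ _ (\int[PP]_z (g z.1 + g z.2))).
  by apply: ge0_le_integral => //; exact: emeasurable_funD.
rewrite ge0_integralD// (_ : 2 = 1 + 1)%R// EFinD ge0_muleDl// mul1e.
apply: leeD.
  rewrite fubini_tonelli1//= /fubini_F.
  apply: ge0_le_integral => //; first by move=> w _; exact: integral_ge0.
    exact: (measurable_fun_fubini_tonelli_F (fun z : Om * Om => g z.1)).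
  by move=> w _; rewrite le_eqVlt; apply/orP; left; apply/eqP; exact: (integral_probability_cst P (g w)).
rewrite fubini_tonelli2//= /fubini_G.
apply: ge0_le_integral => //; first by move=> w _; exact: integral_ge0.
  exact: (measurable_fun_fubini_tonelli_G (fun z : Om * Om => g z.2)).
by move=> w _; rewrite le_eqVlt; apply/orP; left; apply/eqP; exact: (integral_probability_cst P (g w)).
Qed.

Lemma integral_fin_ae (Y : Om -> \bar R) : measurable_fun setT Y ->
  (forall w, 0 <= Y w) -> \int[P]_w Y w < +oo -> {ae P, forall w, Y w < +oo}.
Proof.
move=> mY Y0 Yint.
have iY : P.-integrable setT Y.
  by apply/integrableP; split => //; under eq_integral do rewrite gee0_abs//.
have := integrable_ae measurableT iY.
by apply: filterS => w /(_ I); rewrite ge0_fin_numE.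
Qed.

Context {B : normedModType R} (V : nat -> Om -> B) (a : nat -> R).
Hypothesis sB : separable_space B.
Hypothesis bV : forall n, borel_measurable (V n).
Hypothesis iV : indep_fam P V.
Hypothesis ha0 : forall n, (0 <= a n)%R.
Hypothesis hsum : \sum_(n <oo) (a n)%:E < +oo.
Local Notation path := (g_sigma_algebraType (@cylinder nat B)).
Local Notation b := (tailsum a).
Local Notation N := (fun w => coordinate_sup a (V ^~ w)).
Local Notation L := (fun w => ell a (V ^~ w)).
Local Notation X := (symmetrized V).

Let mN := measurable_N a bV.
Let mL := measurable_L sB bV ha0.
Let mX := measurable_symmetrized sB bV.
Let N0 w : 0 <= N w. Proof. exact: coordinate_sup_ge0. Qed.
Let L0 w : 0 <= L w. Proof. exact: ell_ge0. Qed.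
Let b0 n : (0 <= b n)%R. Proof. exact: tailsum_ge0. Qed.

Section small_coordinates.
Variables (c delta : R).
Hypothesis c0 : (0 <= c)%R.
Hypothesis d0 : (0 < delta)%R.
Hypothesis hd : forall n, delta%:E <= P [set w | (b n * `|V n w| <= c)%R].

Lemma N_fin_of_L_fin : {ae P, forall w, L w < +oo} -> {ae P, forall w, N w < +oo}.
Proof.
move=> Lfin; apply: ae_fin_of_tail => // e e0.
have e0' : (0 < e * (delta / 4))%R by rewrite mulr_gt0// divr_gt0.
have [s s0 hs] := ae_fin_tail mL Lfin e0'.
exists (2 * s + c)%R.
apply: le_trans (N_tail_le_L_tail sB bV iV ha0 hsum _ d0 hd) _.
rewrite (_ : 2 * s / 2 = s)%R; last by field.
apply: le_trans (lee_wpmul2l _ hs) _; first by rewrite lee_fin divr_ge0// ltW.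
have E : (4 / delta * (e * (delta / 4)) = e)%R by field; rewrite gt_eqF.
by rewrite -EFinM E.
Qed.

(** The tail comparison is summed along the geometric levels. Rescaling the starting level from [t0]
    to [t0 / 4] costs 4, which with [4 / delta] makes [16 / delta]. *)
Lemma integral_N_fin_of_L : \int[P]_w L w < +oo -> \int[P]_w N w < +oo.
Proof.
(* Chosen so that [c] is at most half of every level [3 ^+ k * t0], and the shift by [c] is
   absorbed. *)
move=> Lint; pose t0 := (2 * c + 1)%R.
have t00 : (0 < t0)%R by rewrite /t0 ltr_wpDl ?mulr_ge0.
have t40 : (0 < t0 / 4)%R by rewrite divr_gt0.
have cst0 : (0 <= 16 / delta)%R by rewrite divr_ge0// ltW.
apply: le_lt_trans (integral_le_gtail P mN N0 t00) _.
have h : gtail P N t0 <= (16 / delta)%:E * gtail P L (t0 / 4)%R.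
  rewrite -nneseriesZl; last by move=> k _; rewrite mule_ge0// lee_fin mulr_ge0// ?exprn_ge0// ltW.
  apply: lee_nneseries => k *; first by rewrite mule_ge0// lee_fin mulr_ge0// ?exprn_ge0// ltW.
  have k1 : (1 <= 3 ^+ k :> R)%R by rewrite exprn_ege1// ler1n.
  have := N_tail_le_L_tail sB bV iV ha0 hsum (3 ^+ k * t0 / 2)%R d0 hd.
  have E1 (x y : R) : (x * y / 2 / 2 = x * (y / 4))%R by field.
  have E2 (x y : R) : (16 / delta * (x * (y / 4)) = x * y * (4 / delta))%R.
    by field; rewrite gt_eqF.
  rewrite E1.
  move=> le1; rewrite muleA -EFinM.
  rewrite E2 [X in _ <= X * _]EFinM -muleA lee_wpmul2l//.
    by rewrite lee_fin mulr_ge0// ?exprn_ge0// ltW.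
  apply: le_trans le1; rewrite le_measure ?inE//; try exact: measurable_gte.
  move=> w /=; apply: le_lt_trans; rewrite lee_fin.
  have : (t0 <= 3 ^+ k * t0)%R by rewrite ler_peMl// ltW.
  by rewrite {1}/t0; lra.
have h2 := gtail_le_integral P mL L0 t40.
rewrite lte_add_pinfty ?ltry// lte_mul_pinfty//.
apply: le_lt_trans h _; rewrite lte_mul_pinfty//; apply: le_lt_trans h2 _.
by rewrite lte_mul_pinfty// lee_fin.
Qed.

End small_coordinates.

Lemma integral_ell_symmetrized_le :
  \int[PP]_z ell a (X ^~ z) <= 2%:E * \int[P]_w L w.
Proof.
apply: integral_pair_le => //.
- exact: (measurableT_comp (measurable_ell ha0 sB) mX).
- by move=> z; exact: ell_ge0.
- exact: ell_symmetrized_le.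
Qed.

Lemma coordinate_sup_symmetrized_le z : coordinate_sup a (X ^~ z) <= N z.1 + N z.2.
Proof.
apply: ge_ereal_sup => _ [n _ <-].
apply: (@le_trans _ _ ((b n * `|V n z.1|)%:E + (b n * `|V n z.2|)%:E)).
  by rewrite -EFinD lee_fin -mulrDr ler_wpM2l//; exact: ler_normB.
by apply: leeD; apply: ereal_sup_ubound; exists n.
Qed.

(** Hoffmann-Jorgensen gives integrability of the symmetrized [ell]. By Tonelli, freezing the second
    copy at a suitable [w'] keeps it integrable, and [L w] is at most that section plus the constant
    [L w']. *)
Lemma integral_L_fin : {ae P, forall w, L w < +oo} -> \int[P]_w N w < +oo ->
  \int[P]_w L w < +oo.
Proof.
move=> Lfin Nint.
have mY : measurable_fun setT (fun z => ell a (X ^~ z)).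
  exact: (measurableT_comp (measurable_ell ha0 sB) mX).
have mZ : measurable_fun setT (fun z => coordinate_sup a (X ^~ z)).
  exact: (measurableT_comp (@measurable_coordinate_sup _ _ a) mX).
have Yint : \int[PP]_z ell a (X ^~ z) < +oo.
  apply: (@integral_fin_of_quadratic_tail _ _ _ PP _ (fun z => coordinate_sup a (X ^~ z))) => //.
  - by move=> z; exact: ell_ge0.
  - by move=> z; exact: coordinate_sup_ge0.
  - apply: ae_fin_of_tail => // e e0.
    have e20 : (0 < e / 2)%R by rewrite divr_gt0.
    have [s s0 hs] := ae_fin_tail mL Lfin e20.
    exists (2 * s)%R; apply: le_trans (symmetrized_tail_le P sB bV ha0 _) _.
    rewrite (_ : 2 * s / 2 = s)%R; last by field.
    apply: le_trans (lee_wpmul2l _ hs) _ => //.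
    by rewrite -EFinM lee_fin mulrC divfK.
  - apply: le_lt_trans (integral_pair_le mZ mN _ N0 coordinate_sup_symmetrized_le) _.
      by move=> z; exact: coordinate_sup_ge0.
    by rewrite lte_mul_pinfty.
  - by move=> t t0; apply: symmetrized_hoffmann_jorgensen => //; exact: ltW.
have Y0 z : 0 <= ell a (X ^~ z) by exact: ell_ge0.
pose G w' := \int[P]_w ell a (X ^~ (w, w')).
have mG : measurable_fun setT G.
  exact: (measurable_fun_fubini_tonelli_G (fun z => ell a (X ^~ z))).
have G0 w : 0 <= G w by exact: integral_ge0.
have Gint : \int[P]_w G w < +oo.
  apply: le_lt_trans Yint; rewrite le_eqVlt; apply/orP; left; apply/eqP/esym.
  exact: (fubini_tonelli2 (fun z => ell a (X ^~ z))).
have Gfin := integral_fin_ae mG G0 Gint.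
(* Both conditions hold almost surely, and an event of full probability is nonempty. *)
have [w' [Lw' Gw']] : exists w', L w' < +oo /\ G w' < +oo.
  have : {ae P, forall w, L w < +oo /\ G w < +oo}.
    by apply: filterS2 Lfin Gfin => w h1 h2.
  move=> [Z [mZ' Z0 sZ]]; apply: contrapT => nex.
  have ZT : Z = setT by apply/seteqP; split => // w _; apply: sZ => /= h; apply: nex; exists w.
  have : P setT = 0 by rewrite -ZT.
  by rewrite probability_setT => /eqP; rewrite onee_eq0.
have msec : measurable_fun setT (fun w => ell a (X ^~ (w, w'))).
  by apply: (measurableT_comp mY); exact: measurable_pair2.
apply: (@le_lt_trans _ _ (\int[P]_w (ell a (X ^~ (w, w')) + L w'))).
  apply: ge0_le_integral => //.
  - by apply: emeasurable_funD.
  - move=> w _; apply: le_trans (ellD ha0 _ _).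
    rewrite le_eqVlt; apply/orP; left; apply/eqP; congr ell; apply/funext => i.
    by rewrite /symmetrized /= subrK.
rewrite ge0_integralD// integral_probability_cst; exact: lte_add_pinfty.
Qed.

Lemma tailsum_nonincreasing i n : (i <= n)%N -> (b n <= b i)%R.
Proof.
move=> ni; rewrite -lee_fin !tailsumE// (nneseries_split i (n - i)); last first.
  by move=> k _; rewrite lee_fin.
by rewrite subnKC// leeDr// sume_ge0// => k _; rewrite lee_fin.
Qed.

Lemma integral_V_fin n : \int[P]_w N w < +oo -> (0 < b n)%R ->
  \int[P]_w (`|V n w|)%:E < +oo.
Proof.
move=> Nint bn.
have mVn : measurable_fun setT (fun w => (`|V n w|)%:E).
  by apply/measurable_EFinP; exact: borel_measurable_norm.
apply: (@le_lt_trans _ _ (\int[P]_w ((b n)^-1%:E * N w))).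
  apply: ge0_le_integral => //; first exact: measurable_funeM.
  move=> w _; rewrite lee_pdivlMl// -EFinM.
  by apply: ereal_sup_ubound; exists n.
rewrite ge0_integralZl//; last by rewrite lee_fin invr_ge0 ltW.
by rewrite lte_mul_pinfty// lee_fin invr_ge0 ltW.
Qed.

Let bS n : borel_measurable (psum V n).
Proof. exact: (@borel_measurable_sum _ _ _ _ V n.+1 sB bV). Qed.

Lemma integral_psum_fin n : \int[P]_w N w < +oo -> (0 < b n)%R ->
  \int[P]_w (`|psum V n w|)%:E < +oo.
Proof.
move=> Nint bn.
have mVn i : measurable_fun setT (fun w => (`|V i w|)%:E).
  by apply/measurable_EFinP; exact: borel_measurable_norm.
apply: (@le_lt_trans _ _ (\int[P]_w (\sum_(i < n.+1) (`|V i w|)%:E))).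
  apply: ge0_le_integral => //.
  - by apply/measurable_EFinP; exact: borel_measurable_norm.
  - by apply: emeasurable_sum.
  - by move=> w _; rewrite sumEFin lee_fin; exact: ler_norm_sum.
rewrite ge0_integral_sum//; apply: lte_sum_pinfty => i _.
by apply: integral_V_fin => //; apply: lt_le_trans bn _; apply: tailsum_nonincreasing; rewrite -ltnS.
Qed.

Lemma integral_symmetrized_flip (I : pred nat) (g : path -> \bar R) :
  measurable_fun setT g -> (forall x, 0 <= g x) ->
  \int[PP]_z g (flip I (X ^~ z)) = \int[PP]_z g (X ^~ z).
Proof.
move=> mg g0.
pose X1 : {RV PP >-> path} := HB.pack (fun z => X ^~ z) (isMeasurableFun.Build _ _ _ _ _ mX).
have mX2 := measurableT_comp (measurable_flip I) mX.
pose X2 : {RV PP >-> path} := HB.pack (fun z => flip I (X ^~ z)) (isMeasurableFun.Build _ _ _ _ _ mX2).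
transitivity (\int[distribution PP X2]_x g x); first by rewrite ge0_integral_distribution.
transitivity (\int[distribution PP X1]_x g x); last by rewrite ge0_integral_distribution.
apply: eq_measure_integral => C mC _; apply/esym.
exact: symmetrized_flip.
Qed.

Let measurable_path_psum n :
  measurable_fun setT (fun x : path => (`|\sum_(i < n.+1) x i|)%:E).
Proof.
apply/measurable_EFinP; apply: borel_measurable_norm.
apply: (@borel_measurable_sum _ path _ _ (fun i (x : path) => x i)) => // i.
exact: borel_measurable_coord.
Qed.

Let mSX n : measurable_fun setT (fun z => (`|psum X n z|)%:E).
Proof. exact: (measurableT_comp (measurable_path_psum n) mX). Qed.

(* T_n^s is the average of T_k^s and its reflection in the coordinates after n. *)
Lemma integral_psum_symmetrized_le n k : (n <= k)%N ->
  \int[PP]_z (`|psum X n z|)%:E <= \int[PP]_z (`|psum X k z|)%:E.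
Proof.
move=> nk; pose I : pred nat := fun i => (n < i)%N.
pose g (x : path) := (`|\sum_(i < k.+1) x i|)%:E.
have mgf : measurable_fun setT (fun z => g (flip I (X ^~ z))).
  exact: (measurableT_comp (measurable_path_psum k) (measurableT_comp (measurable_flip I) mX)).
have gE : \int[PP]_z g (flip I (X ^~ z)) = \int[PP]_z (`|psum X k z|)%:E.
  by apply: (integral_symmetrized_flip I (measurable_path_psum k)) => x; rewrite lee_fin.
have h : 2%:E * \int[PP]_z (`|psum X n z|)%:E <=
    \int[PP]_z (`|psum X k z|)%:E + \int[PP]_z (`|psum X k z|)%:E.
  rewrite -[X in _ <= _ + X]gE -ge0_integralD//; last by move=> z _; rewrite lee_fin.
  rewrite -ge0_integralZl//.
  apply: ge0_le_integral => //.
  - exact: measurable_funeM.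
  - exact: emeasurable_funD.
  move=> z _; rewrite -EFinM -EFinD lee_fin.
  have -> : (2 * `|psum X n z| = `|psum X n z *+ 2|)%R by rewrite normrMn mulr_natl.
  apply: le_trans (ler_normD _ _).
  rewrite le_eqVlt; apply/orP; left; apply/eqP; congr (`|_|)%R.
  rewrite /psum -!(big_mkord xpredT (fun i => X i z)) -(big_mkord xpredT (flip I (X ^~ z))).
  rewrite !(@big_cat_nat _ _ _ n.+1 0 k.+1)//=.
  rewrite (@eq_big_nat _ _ _ 0 n.+1 (flip I (X ^~ z)) (X ^~ z)); last first.
    by move=> i /andP[_ ni]; rewrite /flip /I ltnNge -ltnS ni.
  rewrite (@eq_big_nat _ _ _ n.+1 k.+1 (flip I (X ^~ z)) (fun i => - X i z)%R); last first.
    by move=> i /andP[ni _]; rewrite /flip /I ni.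
  by rewrite sumrN addrACA subrr addr0 mulr2n.
have [fin|] := ltP (\int[PP]_z (`|psum X k z|)%:E) +oo; last first.
  by rewrite leye_eq => /eqP ->; rewrite leey.
have i0 : 0 <= \int[PP]_z (`|psum X k z|)%:E by exact: integral_ge0.
move: h; rewrite (_ : _ + _ = 2%:E * \int[PP]_z (`|psum X k z|)%:E).
  by rewrite lee_pmul2l.
by rewrite (_ : 2 = 1 + 1)%R// EFinD ge0_muleDl// mul1e.
Qed.

(** For each fixed first sample point the mean is replaced by an average over the second; Tonelli
    then assembles the symmetrized sum. *)
Lemma integral_centered_le n (m : B) : pettis_mean P (psum V n) m ->
  \int[P]_w (`|psum V n w - m|)%:E <= \int[PP]_z (`|psum X n z|)%:E.
Proof.
move=> pm.
have SE z : psum X n z = (psum V n z.1 - psum V n z.2)%R.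
  by rewrite /psum /symmetrized sumrB.
rewrite [leRHS](fubini_tonelli1 (fun z => (`|psum X n z|)%:E))//.
apply: ge0_le_integral => //.
- apply/measurable_EFinP; apply: borel_measurable_norm; apply: borel_measurableB => //.
  exact: borel_measurable_cst.
- exact: (measurable_fun_fubini_tonelli_F (fun z => (`|psum X n z|)%:E)).
move=> w _; apply: le_trans (pettis_mean_norm_le _ (bS n) sB pm) _.
rewrite le_eqVlt; apply/orP; left; apply/eqP; apply: eq_integral => w' _.
by rewrite SE.
Qed.

Lemma centered_psum_cvg0 (m : nat -> B) :
  \int[P]_w L w < +oo -> \int[P]_w N w < +oo ->
  (forall n, (0 < b n)%R -> pettis_mean P (psum V n) (m n)) ->
  (fun n => (b n)%:E * \int[P]_w (`|psum V n w - m n|)%:E) @ \oo --> 0.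
Proof.
move=> Lint Nint pm.
pose e k := (a k)%:E * \int[PP]_z (`|psum X k z|)%:E.
have e0 k : 0 <= e k by rewrite mule_ge0// ?lee_fin//; exact: integral_ge0.
have esum : \sum_(k <oo) e k < +oo.
  (* By Tonelli the series of the [e k] is the expectation of the symmetrized [ell], at most twice
     that of [L]. *)
  apply: (@le_lt_trans _ _ (\int[PP]_z ell a (X ^~ z))); last first.
    by apply: le_lt_trans integral_ell_symmetrized_le _; rewrite lte_mul_pinfty.
  rewrite /ell integral_nneseries//; last 2 first.
  - move=> k; rewrite (_ : (fun _ => _) = fun z => (a k)%:E * (`|psum X k z|)%:E).
      exact: measurable_funeM.
    by apply/funext => z; rewrite -EFinM.
  - by move=> k z _; rewrite lee_fin mulr_ge0.
  rewrite le_eqVlt; apply/orP; left; apply/eqP; apply: eq_eseriesr => k _.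
  rewrite /e -ge0_integralZl//; last by rewrite lee_fin.
apply: (@squeeze_cvge _ _ _ _ (cst 0) _ (fun n => \sum_(n <= k <oo) e k)).
- apply: nearW => n; rewrite mule_ge0 ?lee_fin//=; last exact: integral_ge0.
  (* Here [m n] is arbitrary and the integral may be infinite; the convention [0 * +oo = 0] settles
     the case. *)
  have [->|bn] := eqVneq (b n) 0%R; first by rewrite mul0e nneseries_ge0.
  have {}bn : (0 < b n)%R by rewrite lt_neqAle eq_sym bn b0.
  apply: le_trans (lee_wpmul2l _ (integral_centered_le (pm n bn))) _; first by rewrite lee_fin.
  have i0 k : 0 <= \int[PP]_z (`|psum X k z|)%:E by exact: integral_ge0.
  have fin : \int[PP]_z (`|psum X n z|)%:E \is a fin_num.
    rewrite ge0_fin_numE//.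
    apply: (@le_lt_trans _ _ (2%:E * \int[P]_w (`|psum V n w|)%:E)); last first.
      by rewrite lte_mul_pinfty//; exact: integral_psum_fin.
    apply: (@integral_pair_le _ (fun w => (`|psum V n w|)%:E)) => //.
      by apply/measurable_EFinP; exact: borel_measurable_norm.
    move=> z; rewrite -EFinD lee_fin /psum /symmetrized sumrB; exact: ler_normB.
  rewrite -(fineK fin) muleC tailsumE// -nneseriesZl; last by move=> k _; rewrite lee_fin.
  rewrite eseries_cond [leRHS]eseries_cond.
  apply: lee_nneseries => [k _ _|k /andP[_ nk]]; first by rewrite mule_ge0// lee_fin ?fine_ge0.
  by rewrite fineK// muleC lee_wpmul2l ?lee_fin//; exact: integral_psum_symmetrized_le.
- exact: cvg_cst.
- by apply: nneseries_tail_cvg.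
Qed.

End moments.

(** * The growth of the partial sums *)

Section growth.
Context {R : realType} {B : normedModType R} (a : nat -> R).
Hypothesis ha0 : forall n, (0 <= a n)%R.
Hypothesis hsum : (\sum_(n <oo) (a n)%:E < +oo)%E.
Local Open Scope ereal_scope.

(** Each [a k] occurs in the tails starting at 0, ..., k, hence [k + 1] times. *)
Lemma sum_tailsum : \sum_(n <oo) (tailsum a n)%:E = \sum_(k <oo) (a k * k.+1%:R)%:E.
Proof.
pose f n k := if (n <= k)%N then (a k)%:E else 0.
have f0 n k : 0 <= f n k by rewrite /f; case: ifP => //; rewrite lee_fin.
transitivity (\sum_(n <oo) \sum_(k <oo) f n k).
  apply: eq_eseriesr => n _; rewrite tailsumE// eseries_cond eseries_mkcond.
  by apply: eq_eseriesr => k _.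
rewrite nneseries_interchange//; apply: eq_eseriesr => k _.
rewrite (nneseries_split 0 k.+1)// add0n [X in _ + X]eseries0 ?adde0; last first.
  by move=> n kn _; rewrite /f leqNgt kn.
rewrite (@eq_big_nat _ _ _ 0 k.+1 _ (fun=> (a k)%:E)); last first.
  by move=> n /andP[_ nk]; rewrite /f -ltnS nk.
by rewrite sumEFin big_const_nat subn0 iter_addr_0 mulr_natr.
Qed.

(** A positive liminf would give [e (k + 1) <= |T_k|] from some index on, so that [ell a x] would
    dominate a tail of the divergent series of [(k + 1) a k]. *)
Lemma liminf_average_eq0 (x : nat -> B) :
  \sum_(n <oo) (tailsum a n)%:E = +oo -> ell a x < +oo ->
  limn_einf (fun n => (`|\sum_(i < n.+1) x i| / n.+1%:R)%:E) = 0.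
Proof.
rewrite sum_tailsum => binf xfin; set u := fun n : nat => _.
have u0 n : 0 <= u n by rewrite lee_fin divr_ge0.
have lim_sup : limn_einf u = ereal_sup (range (einfs u)).
  by rewrite limn_einf_lim; apply/cvg_lim => //; exact: cvg_einfs_sup.
apply/eqP; rewrite eq_le; apply/andP; split; last first.
  rewrite lim_sup; apply: le_trans (ereal_sup_ubound _); last by exists 0%N.
  by apply: le_ereal_inf_tmp => _ [k _ <-].
rewrite leNgt; apply/negP; rewrite lim_sup => /ereal_sup_gt [_ [n _ <-] un].
have [e e0 eu] : exists2 e : R, (0 < e)%R & forall k, (n <= k)%N -> (e <= `|\sum_(i < k.+1) x i| / k.+1%:R)%R.
  have lek k : (n <= k)%N -> einfs u n <= u k.
    by move=> nk; apply: ereal_inf_lbound; exists k.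
  have fin : einfs u n \is a fin_num.
    by rewrite ge0_fin_numE ?ltW//; apply: le_lt_trans (lek n (leqnn n)) (ltry _).
  exists (fine (einfs u n)); first by rewrite fine_gt0// un/= -ge0_fin_numE// ltW.
  by move=> k nk; rewrite -lee_fin fineK//; exact: lek.
have c0 k : 0 <= (a k * k.+1%:R)%:E by rewrite lee_fin mulr_ge0.
move: binf; rewrite (nneseries_split 0 n)// add0n sumEFin.
suff : \sum_(n <= k <oo) (a k * k.+1%:R)%:E < +oo.
  by move=> h; move/eqP; apply/negP; rewrite lt_eqF// lte_add_pinfty// ltry.
apply: (@le_lt_trans _ _ ((e^-1)%:E * ell a x)); last first.
  by rewrite lte_mul_pinfty// lee_fin invr_ge0 ltW.
rewrite /ell -nneseriesZl; last by move=> k _; rewrite lee_fin mulr_ge0.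
apply: (@le_trans _ _ (\sum_(n <= k <oo) ((e^-1)%:E * (a k * `|\sum_(i < k.+1) x i|)%:E))).
  rewrite eseries_cond [leRHS]eseries_cond.
  apply: lee_nneseries => // k /andP[_ nk].
  rewrite -EFinM lee_fin mulrCA ler_wpM2l// mulrC ler_pdivlMr//.
  by have := eu k nk; rewrite ler_pdivlMr// mulrC.
rewrite [leRHS](nneseries_split 0 n); last first.
  by move=> k _; rewrite -EFinM lee_fin !mulr_ge0// invr_ge0 ltW.
rewrite add0n leeDr// sume_ge0// => k _.
by rewrite -EFinM lee_fin !mulr_ge0// invr_ge0 ltW.
Qed.

End growth.

(** Turns the supremum condition into a lower bound [delta], one minus the supremum, uniform in [n]
    as desymmetrization requires. *)
Lemma small_coordinates_witness {R : realType} {d} {Om : measurableType d}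
    (P : probability Om R) {B : normedModType R} (V : nat -> Om -> B) (a : nat -> R) (c : R) :
  (forall n, borel_measurable (V n)) ->
  (ereal_sup (range (fun n => P [set w | (c < tailsum a n * `|V n w|)%R])) < 1)%E ->
  exists2 delta : R, 0 < delta &
    forall n, (delta%:E <= P [set w | (tailsum a n * `|V n w| <= c)%R])%E.
Proof.
move=> bV; set s := ereal_sup _ => s1.
have mA n := measurable_coordinate_event a bV n c.
have le_s n : (P [set w | (c < tailsum a n * `|V n w|)%R] <= s)%E.
  by apply: ereal_sup_ubound; exists n.
have s0 : (0 <= s)%E by apply: le_trans (le_s 0%N).
have sfin : s \is a fin_num by rewrite ge0_fin_numE//; exact: lt_trans s1 (ltry _).
exists (1 - fine s); first by rewrite subr_gt0 -lte_fin fineK.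
move=> n; rewrite (_ : [set w | _ <= _] = ~` [set w | (c < tailsum a n * `|V n w|)%R]).
  rewrite [leRHS]probability_setC// EFinB fineK//.
  by apply: leeB.
by apply/seteqP; split => w /=; rewrite leNgt => /negP.
Qed.

Theorem theorem3p1 (R : realType) (d : measure_display) (Om : measurableType d)
  (P : probability Om R) (B : completeNormedModType R)
  (hsep : separable_space B)
  (V : nat -> Om -> B) (hV : forall n, borel_measurable (V n))
  (hind : independent_seq P V)
  (a : nat -> R) (ha0 : forall n, 0 <= a n)
  (hsum : (\sum_(n <oo) (a n)%:E < +oo)%E) :
  let b : nat -> R := tailsum a in
  let T : nat -> Om -> B := psum V in
  let N : Om -> \bar R :=
    fun w => ereal_sup (range (fun n => (b n * `|V n w|)%:E)) in
  let L : Om -> \bar R := fun w => (\sum_(n <oo) (a n * `|T n w|)%:E)%E in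
  let M : Om -> \bar R := fun w => (\sum_(n <oo) (b n * `|V n w|)%:E)%E in
  let Gamma : R -> \bar R :=
    fun t => (\sum_(n <oo) P [set w | (t < b n * `|V n w|)%R])%E in
  (forall w, (L w <= M w)%E) /\
  ((exists c : R, 0 <= c /\
      (ereal_sup (range (fun n => P [set w | (c < b n * `|V n w|)%R])) < 1)%E) ->
   [/\
    (* (a) *)
    (({ae P, forall w, (L w < +oo)%E} -> {ae P, forall w, (N w < +oo)%E}) /\
     ({ae P, forall w, (N w < +oo)%E} <->
      (ereal_inf [set Gamma r | r in [set r : R | (0 <= r)%R]] < +oo)%E)),
    (* (b) *)
    ((\int[P]_w N w < +oo)%E <->
     exists r : R, 0 <= r /\
       (\int[lebesgue_measure]_(t in [set t : R | (r <= t)%R]) Gamma t < +oo)%E),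
    (* (c) *)
    ((\int[P]_w L w < +oo)%E <->
     ({ae P, forall w, (L w < +oo)%E} /\ (\int[P]_w N w < +oo)%E)),
    (* (d) *)
    ((\int[P]_w L w < +oo)%E ->
     [/\ (forall n, 0 < b n -> (\int[P]_w (`|V n w|)%:E < +oo)%E),
         (forall n, 0 < b n -> exists x : B, pettis_mean P (T n) x) &
         (forall m : nat -> B, (forall n, 0 < b n -> pettis_mean P (T n) (m n)) ->
           (fun n => ((b n)%:E * \int[P]_w (`|T n w - m n|)%:E)%E) @ \oo
             --> 0%E)]) &
    (* (e) *)
    ((\sum_(n <oo) (b n)%:E)%E = +oo%E ->
     {ae P, forall w, (L w < +oo)%E} ->
     {ae P, forall w, limn_einf (fun n => (`|T n w| / n.+1%:R)%:E) = 0%E})]).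
Proof.
move=> b T N L M Gamma; split; first by move=> w; exact: ell_le_sum.
move=> [c [c0 /(small_coordinates_witness hV)[delta d0 hd]]].
(* Shared by (c) and (d): in (d) integrability of each [V n] is read off from that of [N]. *)
have L_N : (\int[P]_w L w < +oo -> \int[P]_w N w < +oo)%E.
  exact: (integral_N_fin_of_L hsep hV hind ha0 hsum c0 d0 hd).
split.
- split; last exact: (N_fin_iff hV hind ha0 hsum).
  exact: (N_fin_of_L_fin hsep hV hind ha0 hsum d0 hd).
- exact: (integral_N_fin_iff hV hind ha0 hsum).
- split=> [Lint|[Lfin Nint]]; last exact: (integral_L_fin hsep hV hind ha0 hsum).
  split; last exact: L_N.
  apply: integral_fin_ae Lint; first exact: (measurable_L hsep hV ha0).
  by move=> w; exact: (ell_ge0 ha0 (V ^~ w)).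
- move=> Lint; have Nint := L_N Lint; split=> [n bn|n bn|m pm].
  + exact: (integral_V_fin hV ha0 hsum Nint bn).
  + apply: pettis_mean_exists => //.
      exact: (@borel_measurable_sum _ _ _ _ V n.+1 hsep hV).
    exact: (integral_psum_fin hsep hV ha0 hsum Nint bn).
  + exact: (centered_psum_cvg0 hsep hV hind ha0 hsum Lint Nint pm).
- move=> binf Lfin; apply: filterS Lfin => w Lw.
  exact: (@liminf_average_eq0 _ _ a ha0 hsum (V ^~ w) binf Lw).
Qed.
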